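(* Let a pentapod be given whose platform anchor points $\mathfrak m_1,\dots,\mathfrak m_5$ lie in a plane and whose base anchor points $\mathfrak M_1,\dots,\mathfrak M_5$ lie in a plane, such that there is a regular affine map $\alpha$ between the two planes with $\alpha(\mathfrak m_i)=\mathfrak M_i$ for $i=1,\dots,5$ (a planar affine pentapod). Assume the pentapod is not architecturally singular (equivalently, no four anchor points of the platform, and no four of the base, are collinear). Then the pentapod has mobility 2 exactly in one of the following two cases (up to renumbering of the anchor point pairs and interchanging the roles of platform and base): (1) The affinity $\alpha$ is a congruence transformation. Then the 2-dimensional self-motion is a pure translation. (2) $\mathfrak M_1,\mathfrak M_2,\mathfrak M_3$ lie on a line $\mathfrak g$ which is parallel to the line $\mathfrak h$ spanned by $\mathfrak M_4$ and $\mathfrak M_5$; (hence $\mathfrak m_1,\mathfrak m_2,\mathfrak m_3$ lie on a line parallel to the line spanned by $\mathfrak m_4,\mathfrak m_5$), and the restriction of the affinity to these lines is a congruence transformation. Then the 2-dimensional self-motion is a Schönflies motion (rotations about a fixed axis direction combined with translations) whose axis of rotation is parallel to $\mathfrak g$, $\mathfrak h$ and to the corresponding two lines in the platform.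
   Context: A pentapod consists of five base anchor points $\mathfrak M_i\in\mathbb R^3$ (fixed frame) and five platform anchor points $\mathfrak m_i\in\mathbb R^3$ (moving frame), where $\mathfrak m_i$ and $\mathfrak M_i$ are connected by a leg of fixed length $R_i$. A pose is a Euclidean displacement $x\mapsto Rx+t$; it is admissible if $\|R\mathfrak m_i+t-\mathfrak M_i\|=R_i$ for all $i$. The pentapod has mobility $n$ (an $n$-dimensional self-motion) if for some choice of leg lengths the admissible poses contain an $n$-dimensional continuous family. A pentapod is architecturally singular if in every pose the $5\times 6$ Jacobian matrix formed by the Plücker coordinates of the five leg lines has rank less than five, equivalently the five leg lines always belong to a linear line congruence. Standing assumption: neither all five platform anchor points nor all five base anchor points are collinear. *)

(* Defs.v *)
From HB Require Import structures.
From mathcomp Require Import all_boot all_order all_fingroup all_algebra.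
From mathcomp Require Import all_classical all_reals all_analysis.
Set Implicit Arguments. Unset Strict Implicit. Unset Printing Implicit Defensive.
Import Order.TTheory GRing.Theory Num.Theory.
Import numFieldNormedType.Exports.
Local Open Scope classical_set_scope.
Local Open Scope ring_scope.

Section Pentapod.
Variable R : realType.
Notation vec := 'cV[R]_3.

Definition dot (u v : vec) : R := \sum_(i < 3) u i 0 * v i 0.
Definition enorm (u : vec) : R := Num.sqrt (dot u u).
Definition edist (x y : vec) : R := enorm (x - y).

Definition cross (u v : vec) : vec :=
  \col_(i < 3) (u (inord ((i + 1) %% 3)) 0 * v (inord ((i + 2) %% 3)) 0
              - u (inord ((i + 2) %% 3)) 0 * v (inord ((i + 1) %% 3)) 0).

Definition is_rotation (Q : 'M[R]_3) : Prop := Q^T *m Q = 1%:M /\ \det Q = 1.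

Definition pose := ('M[R]_3 * vec)%type.
Definition act (p : pose) (x : vec) : vec := p.1 *m x + p.2.

Definition plane (n : vec) (c : R) : set vec := [set x | dot n x = c].
Definition line (p d : vec) : set vec := [set x | exists s : R, x = p + s *: d].

Definition all_collinear (pts : 'I_5 -> vec) : Prop :=
  exists p d : vec, d != 0 /\ forall i, line p d (pts i).

Definition regular_affine_between (P Q : set vec) (f : vec -> vec) : Prop :=
  (exists (A : 'M[R]_3) (b : vec), forall x, P x -> f x = A *m x + b) /\
  (forall x, P x -> Q (f x)) /\
  (forall x y, P x -> P y -> f x = f y -> x = y) /\
  (forall y, Q y -> exists x, P x /\ f x = y).

Definition congruent_on (S : set vec) (f : vec -> vec) : Prop :=
  forall x y, S x -> S y -> edist (f x) (f y) = edist x y.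

(* Jacobian (5 x 6) of Pluecker coordinates (direction, moment) of the leg lines
   through the platform point Q m_i + t and the base point M_i *)
Definition plucker_mx (m M : 'I_5 -> vec) (p : pose) : 'M[R]_(5, 3 + 3) :=
  \matrix_(i < 5) row_mx (M i - act p (m i))^T (cross (act p (m i)) (M i))^T.

Definition arch_singular (m M : 'I_5 -> vec) : Prop :=
  forall p : pose, is_rotation p.1 -> (\rank (plucker_mx m M p) < 5)%N.

Definition admissible (m M : 'I_5 -> vec) (r : 'I_5 -> R) (p : pose) : Prop :=
  is_rotation p.1 /\ forall i, edist (act p (m i)) (M i) = r i.

Definition two_dim_self_motion (m M : 'I_5 -> vec) (r : 'I_5 -> R)
    (U : set 'rV[R]_2) (phi : 'rV[R]_2 -> pose) : Prop :=
  open U /\ U !=set0 /\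
  (forall u, U u -> {for u, continuous phi}) /\
  (forall u v, U u -> U v -> phi u = phi v -> u = v) /\
  (forall u, U u -> admissible m M r (phi u)).

Definition has_mobility2 (m M : 'I_5 -> vec) : Prop :=
  exists r U phi, @two_dim_self_motion m M r U phi.

Definition pure_translation (U : set 'rV[R]_2) (phi : 'rV[R]_2 -> pose) : Prop :=
  forall u v, U u -> U v -> (phi u).1 = (phi v).1.

(* Schoenflies motion whose rotation axis has direction dP in the platform frame
   and direction dB in the fixed (base) frame *)
Definition schoenflies (U : set 'rV[R]_2) (phi : 'rV[R]_2 -> pose) (dP dB : vec) : Prop :=
  forall u, U u -> exists c : R, (phi u).1 *m dP = c *: dB.

Definition case2 (m M : 'I_5 -> vec) (P : set vec) (f : vec -> vec)
    (s : 'S_5) : Prop :=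
  let dB := M (s (inord 4)) - M (s (inord 3)) in
  let h := line (M (s (inord 3))) dB in
  dB != 0 /\
  exists pg : vec,
    (forall k : 'I_5, (k < 3)%N -> line pg dB (M (s k))) /\
    congruent_on [set x | P x /\ line pg dB (f x)] f /\
    congruent_on [set x | P x /\ h (f x)] f.

End Pentapod.

(* Main.v *)
(** In affine coordinates [(x, y)] of the two planes the squared length of a leg is, in
    every pose, a quadratic polynomial in [(x, y)] whose coefficients are the dot products
    of [w], [a = Q e1 - A e1] and [b = Q e2 - A e2], where [Q] is the rotational part of the
    pose, [A] the linear part of the affinity, [e1, e2] an orthonormal basis of the platform
    directions and [w] the leg vector at the origin of the coordinates. A pentapod that is not
    architecturally singular has a unique conic [C] through its anchor points, so along a
    self-motion this polynomial moves in a line with direction [C]. If [a] and [b] were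
    independent somewhere, the poses would be finite-to-one over that line; but a
    continuous real function on an open set of the plane always has an infinite fibre. So
    [Q - A] has rank at most one everywhere. If it vanishes identically, the affinity is a
    congruence and the motion a translation. Otherwise the same finiteness argument, applied
    to a coordinate of [w], shows that [C] is invariant under translation along the kernel
    of [Q - A], hence is a pair of parallel lines carrying three and two anchor points, and
    [Q] maps their common direction to its image under the affinity. *)
Require Import Defs.
From HB Require Import structures.
From mathcomp Require Import all_boot all_order all_fingroup all_algebra.
From mathcomp Require Import all_classical all_reals all_analysis.
From mathcomp Require Import ring lra zify.
Set Implicit Arguments. Unset Strict Implicit. Unset Printing Implicit Defensive.
Import Order.TTheory GRing.Theory Num.Theory.
Import numFieldNormedType.Exports.
Local Open Scope classical_set_scope.
Local Open Scope ring_scope.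

(** * Vectors of the Euclidean space *)

Section Vectors.
Context {R : realType}.
Implicit Types (a b n u v w x y z : 'cV[R]_3) (c : R) (Q : 'M[R]_3).

Lemma dotE u v :
  dot u v = u (inord 0) 0 * v (inord 0) 0 + u (inord 1) 0 * v (inord 1) 0
            + u (inord 2) 0 * v (inord 2) 0.
Proof.
rewrite /dot !big_ord_recl big_ord0 addr0 addrA.
by congr (_ * _ + _ * _ + _ * _); congr (fun_of_matrix _ _ _); apply: val_inj;
  rewrite /= ?inordK.
Qed.

Lemma cross0E u v : cross u v (inord 0) 0 =
  u (inord 1) 0 * v (inord 2) 0 - u (inord 2) 0 * v (inord 1) 0.
Proof. by rewrite mxE inordK. Qed.

Lemma cross1E u v : cross u v (inord 1) 0 =
  u (inord 2) 0 * v (inord 0) 0 - u (inord 0) 0 * v (inord 2) 0.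
Proof. by rewrite mxE inordK. Qed.

Lemma cross2E u v : cross u v (inord 2) 0 =
  u (inord 0) 0 * v (inord 1) 0 - u (inord 1) 0 * v (inord 0) 0.
Proof. by rewrite mxE inordK. Qed.

Definition crossE := (cross0E, cross1E, cross2E).

Lemma ord3P (P : 'I_3 -> Prop) :
  P (inord 0) -> P (inord 1) -> P (inord 2) -> forall i, P i.
Proof.
move=> P0 P1 P2 i; rewrite -(inord_val i).
by case: i => [[|[|[|]]]].
Qed.

Lemma vec3P u v : u (inord 0) 0 = v (inord 0) 0 -> u (inord 1) 0 = v (inord 1) 0 ->
  u (inord 2) 0 = v (inord 2) 0 -> u = v.
Proof.
by move=> h0 h1 h2; apply/matrixP => i j; rewrite (ord1 j); move: i; apply: ord3P.
Qed.

Lemma dotC u v : dot u v = dot v u.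
Proof. by rewrite !dotE; ring. Qed.

Lemma dotDl u v w : dot (u + v) w = dot u w + dot v w.
Proof. by rewrite !dotE !mxE; ring. Qed.

Lemma dotDr u v w : dot w (u + v) = dot w u + dot w v.
Proof. by rewrite !dotE !mxE; ring. Qed.

Lemma dotNl u w : dot (- u) w = - dot u w.
Proof. by rewrite !dotE !mxE; ring. Qed.

Lemma dotNr u w : dot w (- u) = - dot w u.
Proof. by rewrite !dotE !mxE; ring. Qed.

Lemma dotZl c u w : dot (c *: u) w = c * dot u w.
Proof. by rewrite !dotE !mxE; ring. Qed.

Lemma dotZr c u w : dot w (c *: u) = c * dot w u.
Proof. by rewrite !dotE !mxE; ring. Qed.

Lemma dot0l u : dot 0 u = 0.
Proof. by rewrite dotE !mxE; ring. Qed.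

Lemma dot0r u : dot u 0 = 0.
Proof. by rewrite dotC dot0l. Qed.

Definition dot_lin := (dotDl, dotDr, dotNl, dotNr, dotZl, dotZr).

Lemma dot_ge0 u : 0 <= dot u u.
Proof. by rewrite dotE !addr_ge0 // -expr2 sqr_ge0. Qed.

Lemma dot_eq0 u : (dot u u == 0) = (u == 0).
Proof.
apply/eqP/eqP => [|->]; last exact: dot0l.
rewrite dotE => h; apply: vec3P; rewrite mxE; nra.
Qed.

Lemma dot_gt0 u : (0 < dot u u) = (u != 0).
Proof. by rewrite lt_def dot_ge0 andbT dot_eq0. Qed.

Lemma dot_crossl u v : dot u (cross u v) = 0.
Proof. by rewrite !dotE !crossE; ring. Qed.

Lemma dot_crossr u v : dot v (cross u v) = 0.
Proof. by rewrite !dotE !crossE; ring. Qed.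

Lemma dot_cross_cross u v x y :
  dot (cross u v) (cross x y) = dot u x * dot v y - dot u y * dot v x.
Proof. by rewrite !dotE !crossE; ring. Qed.

(** The squared triple product is the Gram determinant of the three vectors. It recovers, up to
    sign, the component of [w] along the normal from the length of [w] and its products with [u] and
    [v]. *)
Lemma gram3 u v w : dot w (cross u v) ^+ 2 =
  dot w w * dot (cross u v) (cross u v)
  - (dot w u ^+ 2 * dot v v - 2 * (dot w u * dot w v * dot u v) + dot w v ^+ 2 * dot u u).
Proof. by rewrite !dotE !crossE; ring. Qed.

Lemma cross_neq0_inj u v x : cross u v != 0 ->
  dot x u = 0 -> dot x v = 0 -> dot x (cross u v) = 0 -> x = 0.
Proof.
move=> n0 xu xv xn; have := gram3 u v x.
rewrite xu xv xn !(mul0r, mulr0, expr0n, subr0, addr0) /= => /esym/eqP.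
by rewrite mulf_eq0 !dot_eq0 (negPf n0) orbF => /eqP.
Qed.

Lemma cross_eq0P u v : cross u v = 0 -> dot u v ^+ 2 = dot u u * dot v v.
Proof.
move=> h; have := dot_cross_cross u v u v; rewrite h dot0l => /esym/eqP.
by rewrite subr_eq0 => /eqP ->; rewrite (dotC v u).
Qed.

Lemma cross_indep_neq0 u v : (forall c d : R, c *: u + d *: v = 0 -> c = 0 /\ d = 0) ->
  cross u v != 0.
Proof.
move=> ind; apply/eqP => h.
(* This is the part of [u] orthogonal to [v], scaled by [dot v v]; its squared length is [dot v v]
   times the Gram determinant of [u] and [v]. *)
have hz : dot v v *: u + (- dot u v) *: v = 0.
  apply/eqP; rewrite -dot_eq0 !dot_lin (dotC v u).
  rewrite [X in X == _](_ : _ = dot v v * (dot u u * dot v v - dot u v ^+ 2)); last by ring.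
  by rewrite -cross_eq0P // subrr mulr0.
have [/eqP] := ind _ _ hz.
rewrite dot_eq0 => /eqP v0 _; have := ind 0 1.
rewrite v0 scale0r scaler0 addr0 => /(_ erefl) [_ /eqP].
by rewrite oner_eq0.
Qed.

Lemma dot_mul Q u v : dot (Q *m u) v = dot u (Q^T *m v).
Proof.
rewrite !dotE.
have e (P : 'M[R]_3) w i : (P *m w) i 0 = P i (inord 0) * w (inord 0) 0
    + P i (inord 1) * w (inord 1) 0 + P i (inord 2) * w (inord 2) 0.
  rewrite mxE !big_ord_recl big_ord0 addr0 addrA.
  by congr (_ * _ + _ * _ + _ * _); congr (fun_of_matrix _ _ _); apply: val_inj;
    rewrite /= ?inordK.
rewrite !e !mxE; ring.
Qed.

Definition col3 u v w : 'M[R]_3 := \matrix_(i, j) [:: u i 0; v i 0; w i 0]`_j.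

Lemma mul_col3 Q u v w : Q *m col3 u v w = col3 (Q *m u) (Q *m v) (Q *m w).
Proof.
apply/matrixP => i j; rewrite !mxE.
case: j => [[|[|[|]]]] //= h; apply: eq_bigr => k _; rewrite mxE //.
Qed.

Lemma col3_dot u v w u' v' w' : (col3 u v w)^T *m col3 u' v' w' =
  \matrix_(i, j) [:: [:: dot u u'; dot u v'; dot u w']`_j;
                     [:: dot v u'; dot v v'; dot v w']`_j;
                     [:: dot w u'; dot w v'; dot w w']`_j]`_i.
Proof.
apply/matrixP => i j; rewrite !mxE.
by case: i => [[|[|[|]]]] //= hi; case: j => [[|[|[|]]]] //= hj;
  apply: eq_bigr => k _; rewrite !mxE.
Qed.

Lemma det_col3 u v w : \det (col3 u v w) = dot (cross u v) w.
Proof.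
rewrite (expand_det_row _ ord0) !big_ord_recl big_ord0 addr0 /cofactor.
have d2 (M : 'M[R]_2) : \det M = M 0 0 * M 1 1 - M 0 1 * M 1 0.
  rewrite (expand_det_row _ ord0) !big_ord_recl big_ord0 addr0 /cofactor !det_mx11 !mxE /=.
  rewrite expr0 expr1 mul1r mulN1r mulrN.
  by congr (M _ _ * M _ _ - M _ _ * M _ _); apply: val_inj.
rewrite !d2 !mxE /=.
have -> : (lift ord0 0 : 'I_3) = inord 1 by apply: val_inj; rewrite /= inordK.
have -> : (lift ord0 1 : 'I_3) = inord 2 by apply: val_inj; rewrite /= inordK.
have -> : (ord0 : 'I_3) = inord 0 by apply: val_inj; rewrite /= inordK.
rewrite dotE !crossE /bump /=; ring.
Qed.

Lemma rotation_tr Q : is_rotation Q -> is_rotation Q^T.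
Proof.
by case=> h d; split; rewrite ?det_tr // trmxK; apply: mulmx1C.
Qed.

Lemma rotation_mulK Q x : is_rotation Q -> Q^T *m (Q *m x) = x.
Proof. by case=> h _; rewrite mulmxA h mul1mx. Qed.

Lemma dot_rotation Q x y : is_rotation Q -> dot (Q *m x) (Q *m y) = dot x y.
Proof. by move=> rQ; rewrite dot_mul rotation_mulK. Qed.

(** Paired with any [Q *m z], the two sides are determinants that differ by the factor [\det Q = 1],
    and every vector has the form [Q *m z]. *)
Lemma cross_rotation Q x y : is_rotation Q ->
  cross (Q *m x) (Q *m y) = Q *m cross x y.
Proof.
move=> rQ; apply/eqP; rewrite -subr_eq0 -dot_eq0.
suff h z : dot (cross (Q *m x) (Q *m y)) (Q *m z) = dot (Q *m cross x y) (Q *m z).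
  set d := _ - _; have e : d = Q *m (Q^T *m d).
    by rewrite -{1}(trmxK Q) rotation_mulK //; apply: rotation_tr.
  by rewrite {2}e {1}/d dotDl dotNl h subrr.
rewrite dot_rotation // -!det_col3 -mul_col3 det_mulmx.
by case: rQ => _ ->; rewrite mul1r.
Qed.

(** * Orthonormal frames and the rotations between them *)

Definition orthonormal2 a b : Prop := [/\ dot a a = 1, dot b b = 1 & dot a b = 0].

Lemma orthonormal_cross a b : orthonormal2 a b -> dot (cross a b) (cross a b) = 1.
Proof. by case=> aa bb ab; rewrite dot_cross_cross aa bb ab (dotC b a) ab; ring. Qed.

Lemma orthonormal_cross_neq0 a b : orthonormal2 a b -> cross a b != 0.
Proof. by move=> /orthonormal_cross h; rewrite -dot_eq0 h oner_eq0. Qed.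

Lemma orthonormal_expand a b x : orthonormal2 a b ->
  x = dot x a *: a + dot x b *: b + dot x (cross a b) *: cross a b.
Proof.
move=> o; have [aa bb ab] := o; apply/eqP; rewrite -subr_eq0; apply/eqP.
apply: (cross_neq0_inj (orthonormal_cross_neq0 o)); rewrite !dot_lin.
- by rewrite aa (dotC b) ab (dotC (cross a b)) dot_crossl; ring.
- by rewrite bb ab (dotC (cross a b)) dot_crossr; ring.
- by rewrite dot_crossl dot_crossr orthonormal_cross //; ring.
Qed.

Lemma parseval a b x y : orthonormal2 a b -> dot x y =
  dot x a * dot y a + dot x b * dot y b + dot x (cross a b) * dot y (cross a b).
Proof.
move=> o; rewrite {1}(orthonormal_expand x o) !dot_lin.
by rewrite !(dotC _ y).
Qed.

(** For orthonormal pairs the transpose inverts the matrix of the first frame, so this is the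
    rotation carrying [a], [b] to [u], [v]. *)
Definition frame_rot a b u v : 'M[R]_3 :=
  col3 u v (cross u v) *m (col3 a b (cross a b))^T.

Lemma frame_mx_orthogonal a b : orthonormal2 a b ->
  (col3 a b (cross a b))^T *m col3 a b (cross a b) = 1%:M.
Proof.
move=> o; have [aa bb ab] := o; rewrite col3_dot.
rewrite aa bb ab (dotC b) ab orthonormal_cross // !(dotC (cross a b)) dot_crossl dot_crossr.
apply/matrixP => i j; rewrite !mxE.
by case: i => [[|[|[|]]]] //= hi; case: j => [[|[|[|]]]].
Qed.

Lemma frame_rotP a b u v : orthonormal2 a b -> orthonormal2 u v ->
  is_rotation (frame_rot a b u v).
Proof.
move=> o1 o2; split; rewrite /frame_rot.
  rewrite trmx_mul trmxK mulmxA -(mulmxA (col3 a _ _)) frame_mx_orthogonal // mulmx1.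
  exact/mulmx1C/frame_mx_orthogonal.
by rewrite det_mulmx det_tr !det_col3 !orthonormal_cross // mulr1.
Qed.

Lemma frame_rotE a b u v x : frame_rot a b u v *m x =
  dot a x *: u + dot b x *: v + dot (cross a b) x *: cross u v.
Proof.
have e (w1 w2 w3 y : 'cV[R]_3) : col3 w1 w2 w3 *m y =
    y (inord 0) 0 *: w1 + y (inord 1) 0 *: w2 + y (inord 2) 0 *: w3.
  apply/matrixP => i j; rewrite (ord1 j) !mxE !big_ord_recl big_ord0 addr0 addrA !mxE /=.
  rewrite !(mulrC (y _ _)).
  by congr (_ * _ + _ * _ + _ * _); congr (fun_of_matrix _ _ _); apply: val_inj;
    rewrite /= ?inordK.
rewrite /frame_rot -mulmxA e.
have t (w1 w2 w3 y : 'cV[R]_3) i : ((col3 w1 w2 w3)^T *m y) i 0 =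
    [:: dot w1 y; dot w2 y; dot w3 y]`_i.
  rewrite mxE; case: i => [[|[|[|]]]] //= hi; apply: eq_bigr => k _; by rewrite !mxE.
by rewrite !t !inordK.
Qed.

Lemma exists_orthonormal n : n != 0 -> exists a b,
  [/\ orthonormal2 a b, dot n a = 0 & dot n b = 0].
Proof.
move=> n0.
(* If the cross products of [n] with the standard basis vectors all vanished, so would the
   coordinates of [n]. *)
have [v v0 nv] : exists2 v, v != 0 & dot n v = 0.
  pose E := fun i : 'I_3 => delta_mx i 0 : 'cV[R]_3.
  apply: contrapT => no.
  have c0 i : cross n (E i) = 0.
    apply: contrapT => /eqP h; apply: no; exists (cross n (E i)) => //.
    exact: dot_crossl.
  case/negP: n0; apply/eqP; apply: vec3P; rewrite mxE.
  - have := congr1 (fun z => z (inord 2) 0) (c0 (inord 1)).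
    by rewrite crossE !mxE -!val_eqE /= !inordK //= => h; lra.
  - have := congr1 (fun z => z (inord 0) 0) (c0 (inord 2)).
    by rewrite crossE !mxE -!val_eqE /= !inordK //= => h; lra.
  - have := congr1 (fun z => z (inord 1) 0) (c0 (inord 0)).
    by rewrite crossE !mxE -!val_eqE /= !inordK //= => h; lra.
pose nrm z : 'cV[R]_3 := (Num.sqrt (dot z z))^-1 *: z.
have nrm1 z : z != 0 -> dot (nrm z) (nrm z) = 1.
  rewrite -dot_gt0 => z0; rewrite !dot_lin mulrA -invfM -expr2 sqr_sqrtr ?ltW //.
  by rewrite mulVf // gt_eqF.
have nvn : dot (nrm n) (nrm v) = 0 by rewrite !dot_lin nv !mulr0.
exists (nrm v), (cross (nrm n) (nrm v)); split.
- split; first exact: nrm1.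
    by rewrite orthonormal_cross //; split=> //; exact: nrm1.
  exact: dot_crossr.
- by rewrite dotZr nv mulr0.
- suff : dot (nrm n) (cross (nrm n) (nrm v)) = 0.
    rewrite {1}/nrm dotZl => /eqP; rewrite mulf_eq0 invr_eq0 sqrtr_eq0 leNgt dot_gt0 n0 /=.
    by move/eqP.
  exact: dot_crossl.
Qed.

(** Rotations preserve dot and cross products, so [Q *m x] and [Q' *m x] have the same products with
    the common basis formed by the images of [u], [v] and [cross u v]. *)
Lemma rotation_eq Q Q' u v : is_rotation Q -> is_rotation Q' -> cross u v != 0 ->
  Q *m u = Q' *m u -> Q *m v = Q' *m v -> Q = Q'.
Proof.
move=> rQ rQ' n0 hu hv.
have key x : Q *m x = Q' *m x.
  apply/eqP; rewrite -subr_eq0; apply/eqP.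
  have n1 : cross (Q *m u) (Q *m v) != 0.
    by rewrite cross_rotation // -dot_eq0 dot_rotation // dot_eq0.
  apply: (cross_neq0_inj n1); rewrite dotDl dotNl.
  - by rewrite {2}hu !dot_rotation // subrr.
  - by rewrite {2}hv !dot_rotation // subrr.
  - by rewrite {2}hu {2}hv !cross_rotation // !dot_rotation // subrr.
apply/matrixP => i j; have := congr1 (fun z => z i 0) (key (delta_mx j 0)).
by rewrite -!colE !mxE.
Qed.

Lemma edistE x y : Defs.edist x y = Num.sqrt (dot (x - y) (x - y)).
Proof. by []. Qed.

End Vectors.

(** * Fibres of continuous functions on the plane *)

Section FiniteSets.
Context {R : realType} {T : Type}.
Implicit Types (F : set T) (g : T -> R).

Lemma finite_roots (p : {poly R}) : p != 0 -> finite_set [set x | root p x].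
Proof.
elim: {p}(size p) {-2}p (erefl (size p)) => [|n IH] p sp p0.
  by move: p0; rewrite -size_poly_eq0 sp.
have [[x rx]|no] := pselect (exists x, root p x); last first.
  rewrite (_ : [set x | root p x] = set0) //.
  by apply/seteqP; split=> x //= rx; apply: no; exists x.
have /factor_theorem [q pq] := rx.
have q0 : q != 0 by apply: contraNneq p0 => q0; rewrite pq q0 mul0r.
have sq : size q = n.
  by move: sp; rewrite pq size_Mmonic ?monicXsubC // size_XsubC addn2 /= => -[].
apply: (@sub_finite_set _ _ ([set x] `|` [set y | root q y])).
  move=> y /=; rewrite pq rootM root_XsubC => /orP[|/eqP]; by [right|left].
by rewrite finite_setU; split => //; apply: IH.
Qed.

Lemma finite_fibers F g (X : set R) : finite_set X -> (forall x, F x -> X (g x)) ->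
  (forall c, finite_set (F `&` [set x | g x = c])) -> finite_set F.
Proof.
move=> fX FX fib; apply: (@sub_finite_set _ _ (\bigcup_(c in X) (F `&` [set x | g x = c]))).
  by move=> x Fx; exists (g x); [exact: FX|].
exact: bigcup_finite.
Qed.

Lemma finite_fibers_root F g (p : {poly R}) : p != 0 -> (forall x, F x -> root p (g x)) ->
  (forall c, finite_set (F `&` [set x | g x = c])) -> finite_set F.
Proof. by move=> /finite_roots; apply: finite_fibers. Qed.

(** The square fixes [g] up to sign, so [g] takes at most two values on [F]. *)
Lemma finite_fibers_sqr F g : (forall x y, F x -> F y -> g x ^+ 2 = g y ^+ 2) ->
  (forall c, finite_set (F `&` [set x | g x = c])) -> finite_set F.
Proof.
move=> gF; have [->//|/set0P [y Fy]] := eqVneq F set0.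
apply: (@finite_fibers _ _ [set g y; - g y]) => // x Fx /=.
by have /eqP := gF _ _ Fx Fy; rewrite eqf_sqr => /orP[/eqP|/eqP]; [left|right].
Qed.

Lemma finite_subsingleton F : (forall x y, F x -> F y -> x = y) -> finite_set F.
Proof.
move=> s; have [->//|/set0P [y Fy]] := eqVneq F set0.
by apply: (@sub_finite_set _ _ [set y]) => // x Fx; apply: s.
Qed.

End FiniteSets.

Section PlaneFibers.
Context {R : realType}.
Implicit Types (U : set 'rV[R]_2) (g : 'rV[R]_2 -> R).

Definition pt (s t : R) : 'rV[R]_2 := \row_j [:: s; t]`_j.

(** A finite set is Lebesgue-null, while the interval has measure [b - a]. *)
Lemma infinite_interval (a b : R) : a < b -> infinite_set `]a, b[%classic.
Proof.
move=> ab /finite_set_countable /countable_lebesgue_measure0.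
by rewrite lebesgue_measure_itv /= lte_fin ab -EFinB => -[] /eqP; rewrite subr_eq0 gt_eqF.
Qed.

Lemma cvg_mx (T : Type) (F : set_system T) {FF : Filter F} m n (f : T -> 'M[R]_(m, n))
  (l : 'M[R]_(m, n)) :
  (forall i j, (fun x => f x i j) @ F --> l i j) -> f @ F --> l.
Proof.
move=> h A [P lP sPA]; rewrite /nbhs /= /fmap /=.
have : \forall x \near F, forall i j, P i j (f x i j).
  do 2![apply: filter_forall => ?]; exact/h/lP.
by apply: filterS => x Px; apply: sPA.
Qed.

Lemma cvg_pt (T : Type) (F : set_system T) {FF : Filter F} (f g : T -> R) a b :
  f @ F --> a -> g @ F --> b -> (fun x => pt (f x) (g x)) @ F --> pt a b.
Proof.
move=> fa gb; apply: cvg_mx => i [[|[|]] hj] //; rewrite !mxE /=.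
  rewrite (_ : (fun x => _) = f) //; apply/funext => x; by rewrite mxE.
rewrite (_ : (fun x => _) = g) //; apply/funext => x; by rewrite mxE.
Qed.

(** Either [g] is constant on a vertical segment, or it takes two values there. In the second case a
    value strictly between them is still strictly between on all nearby vertical segments, and each
    of these meets its fibre. *)
Lemma no_finite_fibers U g : open U -> U !=set0 ->
  (forall u, U u -> {for u, continuous g}) ->
  (forall c, finite_set (U `&` [set u | g u = c])) -> False.
Proof.
rewrite openE => oU [u0 Uu0] cg fg.
have [e /= e0 eU] := (nbhs_ballP _ _).1 (oU _ Uu0).
pose s0 := u0 0 0; pose t0 := u0 0 1.
have boxU s t : `|s0 - s| < e -> `|t0 - t| < e -> U (pt s t).
  move=> hs ht; apply: eU; split=> // i j; rewrite /ball_ mxE (ord1 i).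
  case: j => [[|[|]] hj] //=.
    by rewrite (_ : u0 0 _ = s0) //; congr (u0 _ _); apply: val_inj.
  by rewrite (_ : u0 0 _ = t0) //; congr (u0 _ _); apply: val_inj.
have e2 : e / 2 < e by lra.
have ss : `|s0 - s0| < e by rewrite subrr normr0.
have inb t : t0 - e / 2 <= t <= t0 + e / 2 -> `|t0 - t| < e.
  by move=> /andP[h1 h2]; rewrite ltr_norml; apply/andP; split; lra.
have cv s t : U (pt s t) -> {for t, continuous (fun t => g (pt s t))}.
  move=> Ust; apply: (@continuous_comp _ _ _ (pt s) g); last exact: cg.
  by apply: (@cvg_pt _ _ _ (fun=> s) id); [exact: cvg_cst|exact: cvg_id].
have ch s t : U (pt s t) -> {for s, continuous (fun s => g (pt s t))}.
  move=> Ust; apply: (@continuous_comp _ _ _ (pt^~ t) g); last exact: cg.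
  by apply: (@cvg_pt _ _ _ id (fun=> t)); [exact: cvg_id|exact: cvg_cst].
have [t1 [t2 [h1 h2 lt12]]] : exists t1 t2, [/\ t0 - e / 2 <= t1 <= t0 + e / 2,
    t0 - e / 2 <= t2 <= t0 + e / 2 & g (pt s0 t1) < g (pt s0 t2)].
  apply: contrapT => no.
  have cst t : t0 - e / 2 <= t <= t0 + e / 2 -> g (pt s0 t) = g (pt s0 t0).
    move=> ht; have ht0 : t0 - e / 2 <= t0 <= t0 + e / 2 by apply/andP; split; lra.
    case: (ltgtP (g (pt s0 t)) (g (pt s0 t0))) => // lt; case: no;
      [exists t, t0 | exists t0, t]; by split.
  (* On a segment where [g] is constant, the second coordinate runs through an interval inside a
     single fibre. *)
  have /finite_image -/(_ _ (fun u => u 0 1)) := fg (g (pt s0 t0)).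
  apply: (@sub_infinite_set _ `]t0 - e / 2, t0 + e / 2[%classic); last first.
    by apply: infinite_interval; lra.
  move=> t; rewrite /= in_itv /= => /andP[ht1 ht2].
  have ht : t0 - e / 2 <= t <= t0 + e / 2 by apply/andP; split; lra.
  exists (pt s0 t); last by rewrite mxE.
  by split; [apply: boxU => //; exact: inb|exact: cst].
have U1 := boxU _ _ ss (inb _ h1); have U2 := boxU _ _ ss (inb _ h2).
pose c := (g (pt s0 t1) + g (pt s0 t2)) / 2.
have c1 : g (pt s0 t1) < c by rewrite /c; lra.
have c2 : c < g (pt s0 t2) by rewrite /c; lra.
have : \forall s \near s0, `|s0 - s| < e /\ g (pt s t1) < c /\ c < g (pt s t2).
  near=> s; split; first by near: s; apply/nbhs_ballP; exists e.
  by split; near: s; [apply: (cvgr_lt _ (ch _ _ U1))|apply: (cvgr_gt _ (ch _ _ U2))].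
move=> /nbhs_ballP [d /= d0 hd].
(* The first coordinates of the fibre over [c] cover an interval to the right of [s0], by the
   intermediate value theorem on each vertical segment. *)
have /finite_image -/(_ _ (fun u => u 0 0)) := fg c.
apply: (@sub_infinite_set _ `]s0, s0 + d[%classic); last first.
  by apply: infinite_interval; lra.
move=> s; rewrite /= in_itv /= => /andP[hs1 hs2].
have /hd [se [lt1 lt2]] : ball s0 d s.
  by rewrite /ball /= ltr_norml; apply/andP; split; lra.
have [t ht gt] : exists2 t, t0 - e / 2 <= t <= t0 + e / 2 & g (pt s t) = c.
  have ivt a b : a <= b -> t0 - e / 2 <= a <= t0 + e / 2 -> t0 - e / 2 <= b <= t0 + e / 2 ->
      Num.min (g (pt s a)) (g (pt s b)) <= c <= Num.max (g (pt s a)) (g (pt s b)) ->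
      exists2 t, t0 - e / 2 <= t <= t0 + e / 2 & g (pt s t) = c.
    move=> ab /andP[ha1 ha2] /andP[hb1 hb2] hc.
    have [|t] := @IVT R (fun t => g (pt s t)) a b c ab _ hc.
      apply: continuous_in_subspaceT => t; rewrite inE /= in_itv /= => /andP[hta htb].
      by apply: cv; apply: boxU => //; apply: inb; apply/andP; split; lra.
    rewrite in_itv /= => /andP[hta htb] gt; exists t => //.
    by apply/andP; split; lra.
  have [le12|/ltW le21] := leP t1 t2.
    by apply: (ivt t1 t2) => //; rewrite ge_min le_max (ltW lt1) (ltW lt2) orbT.
  by apply: (ivt t2 t1) => //; rewrite ge_min le_max (ltW lt1) (ltW lt2) orbT.
exists (pt s t); last by rewrite mxE.
by split=> //; apply: boxU => //; exact: inb.
Unshelve. all: by end_near. Qed.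
End PlaneFibers.

(** * Poses with prescribed leg coefficients *)

Section FinitePoses.
Context {R : realType}.
Notation vec := 'cV[R]_3.

Lemma orthonormal_rotation (Q : 'M[R]_3) (a b : vec) : is_rotation Q ->
  orthonormal2 a b -> orthonormal2 (Q *m a) (Q *m b).
Proof. by move=> rQ [aa bb ab]; split; rewrite dot_rotation. Qed.

(* The four products [E_i . Q e_j] with [j <= 2] are known up to one parameter
   [x]; as [E1] and [E2] have prescribed lengths and angle, their third
   coordinates in the frame of [Q e1, Q e2] give a monic quartic equation in [x]. *)
Lemma finite_poses (T : Type) (F : set T) (Q : T -> 'M[R]_3) (w : T -> vec)
    (e1 e2 E1 E2 : vec) (A B D W X Y : R) (x y : 'M[R]_3 -> vec) :
  orthonormal2 e1 e2 -> cross E1 E2 != 0 ->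
  (forall u, F u -> is_rotation (Q u)) ->
  (forall u, F u -> dot E1 (Q u *m e1) = A) ->
  (forall u, F u -> dot E2 (Q u *m e2) = B) ->
  (forall u, F u -> dot E1 (Q u *m e2) + dot E2 (Q u *m e1) = D) ->
  (forall u, F u -> dot (w u) (w u) = W) ->
  (forall u, F u -> dot (w u) (x (Q u)) = X) ->
  (forall u, F u -> dot (w u) (y (Q u)) = Y) ->
  (forall u, F u -> cross (x (Q u)) (y (Q u)) != 0) ->
  (forall u v, F u -> F v -> Q u = Q v -> w u = w v -> u = v) ->
  finite_set F.
Proof.
move=> o n0 rQ hA hB hD hW hX hY hxy inj.
pose f3 u := cross (Q u *m e1) (Q u *m e2).
have pv u (z z' : vec) : F u -> dot z z' = dot z (Q u *m e1) * dot z' (Q u *m e1)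
    + dot z (Q u *m e2) * dot z' (Q u *m e2) + dot z (f3 u) * dot z' (f3 u).
  by move=> Fu; apply: parseval; apply: orthonormal_rotation => //; exact: rQ.
(* Let [t] be [dot E1 (Q u *m e2)], and [a], [b] the third coordinates of [E1], [E2]. Parseval gives
   a^2 = G - t^2, b^2 = H + 2 D t - t^2 and a b = L + M t; [p] is a^2 b^2 - (a b)^2 as a polynomial
   in t. *)
pose G := dot E1 E1 - A ^+ 2; pose H := dot E2 E2 - B ^+ 2 - D ^+ 2.
pose L := dot E1 E2 - A * D; pose M := A - B.
pose p := Poly [:: G * H - L ^+ 2; 2 * G * D - 2 * L * M; - G - H - M ^+ 2; - 2 * D; 1].
have p0 : p != 0.
  apply/eqP => /(congr1 (fun q : {poly R} => q`_4)).
  by rewrite coef_Poly coef0 /= => /eqP; rewrite oner_eq0.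
apply: (finite_fibers_root (g := fun u => dot E1 (Q u *m e2)) p0) => [u Fu|c].
  rewrite /root /p horner_Poly /=; apply/eqP.
  have := pv _ E1 E1 Fu; have := pv _ E2 E2 Fu; have := pv _ E1 E2 Fu.
  have := hD _ Fu; rewrite (hA _ Fu) (hB _ Fu) /G /H /L /M.
  move: (dot E1 (Q u *m e2)) (dot E2 (Q u *m e1)) (dot E1 (f3 u)) (dot E2 (f3 u)).
  by move=> t s a b <- -> -> ->; ring.
(* With [t] fixed, the length of [E1], and below that of [E2], leaves only the sign of the third
   coordinate open. *)
apply: (finite_fibers_sqr (g := fun u => dot E1 (f3 u))) => [u v [Fu uc] [Fv vc]|c1].
  have := pv _ E1 E1 Fu; have := pv _ E1 E1 Fv.
  move: uc vc => /= -> ->; rewrite !hA // -!expr2 => ->.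
  by move/addrI.
apply: (finite_fibers_sqr (g := fun u => dot E2 (f3 u)))
   => [u v [[Fu uc] uc1] [[Fv vc] vc1]|c2].
  have := pv _ E2 E2 Fu; have := pv _ E2 E2 Fv.
  have := hD _ Fu; have := hD _ Fv.
  move: uc vc => /= -> ->; rewrite !hB // -!expr2 => <- /addrI -> ->.
  by move/addrI.
set F' := _ `&` _.
have F'F u : F' u -> F u by move=> [[[]]].
(* All coordinates of [E1] and [E2] in the moving frame are now fixed, so the transposed rotations
   agree on these two independent vectors. *)
have eQ u v : F' u -> F' v -> Q u = Q v.
  move=> Fu' Fv'; have Fu := F'F _ Fu'; have Fv := F'F _ Fv'.
  move: Fu' Fv' => [[[_ /= uc] /= uc1] /= uc2] [[[_ /= vc] /= vc1] /= vc2].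
  have eQx (E : vec) : dot E (Q u *m e1) = dot E (Q v *m e1) ->
      dot E (Q u *m e2) = dot E (Q v *m e2) -> dot E (f3 u) = dot E (f3 v) ->
      (Q u)^T *m E = (Q v)^T *m E.
    rewrite /f3 !cross_rotation; try exact: rQ.
    rewrite ![dot E _]dotC !dot_mul => h1 h2 h3.
    rewrite (orthonormal_expand ((Q u)^T *m E) o) (orthonormal_expand ((Q v)^T *m E) o).
    by rewrite ![dot (_ *m E) _]dotC h1 h2 h3.
  apply: (can_inj (@trmxK _ _ _)); apply: (rotation_eq (u := E1) (v := E2)) => //.
  - exact/rotation_tr/rQ.
  - exact/rotation_tr/rQ.
  - by apply: eQx; rewrite ?hA ?uc ?vc ?uc1 ?vc1.
  - apply: eQx; rewrite ?hB ?uc2 ?vc2 //.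
    by have := hD _ Fu; rewrite -(hD _ Fv) uc vc => /addrI.
(* By [gram3], the length of [w] and its products with [x] and [y] determine its normal component up
   to sign. *)
apply: (finite_fibers_sqr (g := fun u => dot (w u) (cross (x (Q u)) (y (Q u)))))
   => [u v Fu Fv|c3].
  by rewrite !gram3 !hW ?hX ?hY ?(eQ _ _ Fu Fv) ?hX ?hY; try exact: F'F.
apply: finite_subsingleton => u v [Fu /= uc] [Fv /= vc].
have Quv := eQ _ _ Fu Fv.
apply: inj => //; try exact: F'F.
apply/eqP; rewrite -subr_eq0; apply/eqP.
apply: (cross_neq0_inj (hxy _ (F'F _ Fu))); rewrite dotDl dotNl.
- by rewrite {2}Quv !hX ?subrr; try exact: F'F.
- by rewrite {2}Quv !hY ?subrr; try exact: F'F.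
- by rewrite uc Quv vc subrr.
Qed.

End FinitePoses.

(** * Conics through the anchor points *)

Section Conics.
Context {R : realType}.
Notation vec := 'cV[R]_3.

Definition coefs (a b c d e f : R) : 'rV[R]_6 := \row_k [:: a; b; c; d; e; f]`_k.

Definition quad (z : 'rV[R]_6) (x y : R) : R :=
  (z *m (coefs 1 x y (x ^+ 2) (x * y) (y ^+ 2))^T) 0 0.

Lemma sum6 (F : 'I_6 -> R) : \sum_i F i = F (inord 0) + F (inord 1) + F (inord 2)
  + F (inord 3) + F (inord 4) + F (inord 5).
Proof.
rewrite !big_ord_recl big_ord0 addr0 !addrA.
by congr (F _ + F _ + F _ + F _ + F _ + F _); apply: val_inj; rewrite /= ?inordK.
Qed.

Lemma quadE z x y : quad z x y = z 0 (inord 0) + z 0 (inord 1) * x + z 0 (inord 2) * y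
  + z 0 (inord 3) * x ^+ 2 + z 0 (inord 4) * (x * y) + z 0 (inord 5) * y ^+ 2.
Proof. by rewrite /quad mxE sum6 !mxE !inordK //= mulr1. Qed.

Lemma quad_coefs a b c d e f x y : quad (coefs a b c d e f) x y =
  a + b * x + c * y + d * x ^+ 2 + e * (x * y) + f * y ^+ 2.
Proof. by rewrite quadE !mxE !inordK. Qed.

Lemma ord6P (P : 'I_6 -> Prop) : P (inord 0) -> P (inord 1) -> P (inord 2) ->
  P (inord 3) -> P (inord 4) -> P (inord 5) -> forall i, P i.
Proof.
move=> P0 P1 P2 P3 P4 P5 i; rewrite -(inord_val i).
by case: i => [[|[|[|[|[|[|]]]]]]].
Qed.

Lemma quadB z z' x y : quad (z - z') x y = quad z x y - quad z' x y.
Proof. by rewrite !quadE !mxE; ring. Qed.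

Lemma cross_affine (p0 p1 p2 q0 q1 q2 : vec) (x y : R) :
  cross (p0 + x *: p1 + y *: p2) (q0 + x *: q1 + y *: q2) =
  cross p0 q0 + x *: (cross p0 q1 + cross p1 q0) + y *: (cross p0 q2 + cross p2 q0)
  + x ^+ 2 *: cross p1 q1 + (x * y) *: (cross p1 q2 + cross p2 q1) + y ^+ 2 *: cross p2 q2.
Proof. by apply: vec3P; rewrite ?crossE !mxE ?inordK //=; ring. Qed.

(* The rows of the Jacobian are quadratic in the coordinates of the anchor
   points, so its rank is at most that of the 5 x 6 matrix of monomials. *)
Lemma unique_conic (m M : 'I_5 -> vec) (o e1 e2 O E1 E2 : vec) (X Y : 'I_5 -> R) :
  (forall i, m i = o + X i *: e1 + Y i *: e2) ->
  (forall i, M i = O + X i *: E1 + Y i *: E2) ->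
  ~ arch_singular m M ->
  exists C, [/\ C != 0, (forall i, quad C (X i) (Y i) = 0) &
    forall z, (forall i, quad z (X i) (Y i) = 0) -> exists l, z = l *: C].
Proof.
move=> hm hM ns.
have [p [rp rk]] : exists p : pose R, is_rotation p.1 /\ (5 <= \rank (plucker_mx m M p))%N.
  apply: contrapT => no; apply: ns => p rp; rewrite ltnNge; apply/negP => h.
  by apply: no; exists p.
pose V : 'M[R]_(5, 6) :=
  \matrix_i coefs 1 (X i) (Y i) (X i ^+ 2) (X i * Y i) (Y i ^+ 2).
pose p0 := p.1 *m o + p.2; pose p1 := p.1 *m e1; pose p2 := p.1 *m e2.
(* Row k holds the coefficients of the k-th monomial in the leg direction and its moment. The
   direction is affine in the coordinates, whence the zero blocks in the last three rows. *)
pose B : 'M[R]_(6, 3 + 3) := \matrix_k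
  [:: row_mx (O - p0)^T (cross p0 O)^T;
      row_mx (E1 - p1)^T (cross p0 E1 + cross p1 O)^T;
      row_mx (E2 - p2)^T (cross p0 E2 + cross p2 O)^T;
      row_mx 0 (cross p1 E1)^T;
      row_mx 0 (cross p1 E2 + cross p2 E1)^T;
      row_mx 0 (cross p2 E2)^T]`_k.
have VB : plucker_mx m M p = V *m B.
  have hact i : Defs.act p (m i) = p0 + X i *: p1 + Y i *: p2.
    by rewrite /Defs.act hm !mulmxDr -!scalemxAr /p0 /p1 /p2 -!addrA [p.2 + _]addrC !addrA.
  apply/matrixP => i j; rewrite !mxE sum6 !mxE !inordK //=.
  rewrite hact hM; case: (fintype.split_ordP j) => k ->; rewrite ?row_mxEl ?row_mxEr.
    by rewrite !mxE; ring.
  rewrite cross_affine ![_^T _ _]mxE.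
  move: (cross p0 O) (cross p0 E1) (cross p1 O) (cross p0 E2) (cross p2 O) (cross p1 E1)
    (cross p1 E2) (cross p2 E1) (cross p2 E2) => c1 c2 c3 c4 c5 c6 c7 c8 c9.
  by rewrite !mxE; ring.
have rV : \rank V^T = 5.
  rewrite mxrank_tr; apply/eqP; rewrite eqn_leq rank_leq_row /=.
  by apply: leq_trans rk _; rewrite VB mxrankM_maxl.
have zV z : (z *m V^T = 0) <-> (forall i, quad z (X i) (Y i) = 0).
  have e i : (z *m V^T) 0 i = quad z (X i) (Y i).
    by rewrite /quad !mxE; apply: eq_bigr => k _; rewrite !mxE.
  split=> [h i|h]; first by rewrite -e h mxE.
  by apply/rowP => i; rewrite e h mxE.
(* Rank five leaves a one-dimensional space of conics through the anchor points, spanned by any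
   nonzero row of [K]. *)
pose K := kermx V^T.
have rK : \rank K = 1%N by rewrite mxrank_ker rV.
have [i Ki] : exists i, row i K != 0.
  apply/existsP; rewrite -negb_forall; apply/negP => /forallP h.
  suff K0 : K = 0 by move: rK; rewrite K0 mxrank0.
  by apply/row_matrixP => i; rewrite row0; apply/eqP.
exists (row i K); split=> //.
  by apply/zV; apply/sub_kermxP; exact: row_sub.
move=> z /zV /sub_kermxP zK.
have : (K <= row i K)%MS.
  by rewrite -(mxrank_leqif_sup (row_sub i K)).2 rank_rV Ki rK.
by move=> Ksub; apply/sub_rVP; exact: submx_trans zK Ksub.
Qed.

End Conics.

(** The permutation enumerates [A] first and its complement afterwards. *)
Lemma perm_split (A : {set 'I_5}) : #|A| = 3%N ->
  exists s : 'S_5, [/\ forall k : 'I_5, (k < 3)%N -> s k \in A,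
    s (inord 3) \notin A & s (inord 4) \notin A].
Proof.
move=> cA; pose L := enum A ++ enum (~: A)%SET.
have cB : #|(~: A)%SET| = 2%N.
  by have := cardsC A; rewrite cA card_ord => /(@addnI 3 _ 2).
have sL : size L = 5%N by rewrite size_cat -!cardE cA cB.
have uL : uniq L.
  rewrite cat_uniq !enum_uniq andbT /=; apply/hasPn => i.
  by rewrite !mem_enum inE.
have inj : injective (fun i : 'I_5 => nth ord0 L i).
  move=> i j /eqP; rewrite nth_uniq ?sL ?ltn_ord // => /eqP ij; exact: val_inj.
exists (perm inj); split=> [k k3||]; rewrite permE nth_cat -cardE cA ?inordK //=.
- by rewrite k3 -mem_enum mem_nth // -cardE cA.
- have : nth ord0 (enum (~: A)%SET) (3 - 3) \in (~: A)%SET.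
    by rewrite -mem_enum mem_nth // -cardE cB.
  by rewrite inE.
- have : nth ord0 (enum (~: A)%SET) (4 - 3) \in (~: A)%SET.
    by rewrite -mem_enum mem_nth // -cardE cB.
  by rewrite inE.
Qed.

(** * Splitting the anchor points over two parallel lines *)

Section UniqueConic.
Context {R : realType}.
Variables (C : 'rV[R]_6) (X Y : 'I_5 -> R).
Hypothesis C0 : C != 0.
Hypothesis CXY : forall i, quad C (X i) (Y i) = 0.
Hypothesis Cuniq : forall z, (forall i, quad z (X i) (Y i) = 0) -> exists l, z = l *: C.
Variables (v1 v2 : R).
Hypothesis v0 : v1 ^+ 2 + v2 ^+ 2 != 0.

(** The level lines of this linear form have direction [(v1, v2)]. *)
Let l i := v2 * X i - v1 * Y i.

(* Otherwise the line [l = r] and two distinct lines through [(x0, y0)] would give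
   two distinct conics through the five points. *)
Lemma not_line_and_point r x0 y0 : ~ (forall i, l i = r \/ (X i = x0 /\ Y i = y0)).
Proof.
move=> h; pose l0 := v2 * x0 - v1 * y0; pose h0 := v1 * x0 + v2 * y0.
(* The first conic joins the line [l = r] with its parallel through [(x0, y0)]; the second, below,
   joins it with the perpendicular through [(x0, y0)]. *)
have [s1 e1] : exists s1, coefs (r * l0) (- v2 * (r + l0)) (v1 * (r + l0))
    (v2 ^+ 2) (- 2 * v1 * v2) (v1 ^+ 2) = s1 *: C.
  apply: Cuniq => i; rewrite quad_coefs.
  transitivity ((l i - r) * (l i - l0)); first by rewrite /l; ring.
  by case: (h i) => [->|[e1 e2]]; rewrite /l ?e1 ?e2 /l0; ring.
have [s2 e2] : exists s2, coefs (r * h0) (- v2 * h0 - r * v1) (v1 * h0 - r * v2)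
    (v1 * v2) (v2 ^+ 2 - v1 ^+ 2) (- (v1 * v2)) = s2 *: C.
  apply: Cuniq => i; rewrite quad_coefs.
  transitivity ((l i - r) * (v1 * X i + v2 * Y i - h0)); first by rewrite /l; ring.
  by case: (h i) => [->|[e2 e3]]; rewrite /l ?e2 ?e3 /h0; ring.
(* Both conics are multiples of [C], so their quadratic parts agree after each is multiplied by the
   scalar of the other. This forces [s1 = s2 = 0]. *)
have c3 : s2 * v2 ^+ 2 = s1 * (v1 * v2).
  have := congr1 (fun z : 'rV_6 => z 0 (inord 3)) e1.
  have := congr1 (fun z : 'rV_6 => z 0 (inord 3)) e2.
  by rewrite !mxE !inordK //= => -> ->; ring.
have c4 : s2 * (- 2 * v1 * v2) = s1 * (v2 ^+ 2 - v1 ^+ 2).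
  have := congr1 (fun z : 'rV_6 => z 0 (inord 4)) e1.
  have := congr1 (fun z : 'rV_6 => z 0 (inord 4)) e2.
  by rewrite !mxE !inordK //= => -> ->; ring.
have c5 : s2 * v1 ^+ 2 = s1 * - (v1 * v2).
  have := congr1 (fun z : 'rV_6 => z 0 (inord 5)) e1.
  have := congr1 (fun z : 'rV_6 => z 0 (inord 5)) e2.
  by rewrite !mxE !inordK //= => -> ->; ring.
have s20 : s2 = 0.
  apply/eqP; have : s2 * (v1 ^+ 2 + v2 ^+ 2) = 0 by rewrite mulrDr c3 c5; ring.
  by move/eqP; rewrite mulf_eq0 (negPf v0) orbF.
have s10 : s1 = 0.
  apply/eqP; have : s1 * (v1 ^+ 2 + v2 ^+ 2) ^+ 2 = 0.
    transitivity ((s1 * (v2 ^+ 2 - v1 ^+ 2)) * (v2 ^+ 2 - v1 ^+ 2)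
                  + 4 * v1 * v2 * (s1 * (v1 * v2))); first by ring.
    by rewrite -c3 -c4 s20; ring.
  by move/eqP; rewrite mulf_eq0 expf_eq0 /= (negPf v0) orbF.
case/negP: v0; rewrite s10 scale0r in e1.
have /eqP := congr1 (fun z : 'rV_6 => z 0 (inord 3)) e1.
have /eqP := congr1 (fun z : 'rV_6 => z 0 (inord 5)) e1.
by rewrite !mxE !inordK //= => /eqP -> /eqP ->; rewrite addr0.
Qed.

(** Together [K1], [K2], [K3] say that the derivative of [quad C] in direction [(v1, v2)] vanishes
    identically. *)
Hypothesis K1 : C 0 (inord 1) * v1 + C 0 (inord 2) * v2 = 0.
Hypothesis K2 : 2 * C 0 (inord 3) * v1 + C 0 (inord 4) * v2 = 0.
Hypothesis K3 : C 0 (inord 4) * v1 + 2 * C 0 (inord 5) * v2 = 0.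

Let N := v1 ^+ 2 + v2 ^+ 2.
(** A conic invariant along [(v1, v2)] is a polynomial in the form [l]: [N * quad C] equals [p]
    evaluated at [l]. *)
Let p : {poly R} := Poly [:: N * C 0 (inord 0);
  C 0 (inord 1) * v2 - C 0 (inord 2) * v1; C 0 (inord 3) + C 0 (inord 5)].

Lemma conic_coefs : [/\ N * C 0 (inord 1) = (C 0 (inord 1) * v2 - C 0 (inord 2) * v1) * v2,
  N * C 0 (inord 2) = - (C 0 (inord 1) * v2 - C 0 (inord 2) * v1) * v1,
  N * C 0 (inord 3) = (C 0 (inord 3) + C 0 (inord 5)) * v2 ^+ 2,
  N * C 0 (inord 4) = (C 0 (inord 3) + C 0 (inord 5)) * (- 2 * v1 * v2) &
  N * C 0 (inord 5) = (C 0 (inord 3) + C 0 (inord 5)) * v1 ^+ 2].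
Proof.
rewrite /N; move: K1 K2 K3.
move: (C 0 (inord 1)) (C 0 (inord 2)) (C 0 (inord 3)) (C 0 (inord 4)) (C 0 (inord 5)).
move=> c1 c2 c3 c4 c5 k1 k2 k3.
have := (congr1 ( *%R v1) k1, congr1 ( *%R v2) k1, congr1 ( *%R v1) k2, congr1 ( *%R v2) k2,
  congr1 ( *%R v1) k3, congr1 ( *%R v2) k3).
by rewrite !mulr0 => -[[[[[? ?] ?] ?] ?] ?]; split; lra.
Qed.

Lemma conic_root i : root p (l i).
Proof.
rewrite /root /p horner_Poly /=; apply/eqP.
transitivity (N * quad C (X i) (Y i)); last by rewrite CXY mulr0.
have [h1 h2 h3 h4 h5] := conic_coefs.
by rewrite quadE !mulrDr !mulrA h1 h2 h3 h4 h5 /l; ring.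
Qed.

Lemma conic_poly_neq0 : p != 0.
Proof.
apply/eqP => p0; case/negP: C0; apply/eqP/rowP; have [h1 h2 h3 h4 h5] := conic_coefs.
have e j : p`_j = 0 by rewrite p0 coef0.
move: (e 0%N) (e 1%N) (e 2%N); rewrite !coef_Poly /= => e0 e1 e2.
rewrite e1 e2 oppr0 !mul0r in h1 h2 h3 h4 h5.
by apply: ord6P; rewrite mxE; apply/eqP; move: e0 h1 h2 h3 h4 h5;
  do ![move/eqP; rewrite mulf_eq0 (negPf v0) /= => ?].
Qed.

(** The anchor points have at most two values of [l], the roots of [p]. By [not_line_and_point] each
    level carries at least two of the five points, which leaves three and two. *)
Lemma three_two_split : exists s : 'S_5, exists r,
  [/\ forall k : 'I_5, (k < 3)%N -> l (s k) = r, l (s (inord 3)) = l (s (inord 4)) &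
    ~ (X (s (inord 3)) = X (s (inord 4)) /\ Y (s (inord 3)) = Y (s (inord 4)))].
Proof.
have card_bound (D : {set 'I_5}) r : (forall i, i \notin D -> l i = r) -> (1 < #|D|)%N.
  move=> h; rewrite ltnNge; apply/negP => /card_le1P D1.
  have [D0|/finset.set0Pn [i iD]] := eqVneq D finset.set0.
    apply: (@not_line_and_point r (X ord0) (Y ord0)) => i; left; apply: h.
    by rewrite D0 inE.
  apply: (@not_line_and_point r (X i) (Y i)) => j.
  have [jD|jD] := boolP (j \in D); last by left; exact: h.
  by right; have := D1 _ iD j; rewrite jD => /esym /eqP ->.
pose A := [set i | l i == l ord0]%SET.
have constB i j : i \notin A -> j \notin A -> l i = l j.
  rewrite !inE => iA jA; apply/eqP; apply: contraT => ij.
  (* Three distinct values of [l] would be three roots of a nonzero polynomial of degree at most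
     two. *)
  have : (size [:: l ord0; l i; l j] < size p)%N.
    apply: max_poly_roots; rewrite ?conic_poly_neq0 /= ?conic_root //.
    by rewrite !inE negb_or ![l ord0 == _]eq_sym iA jA ij.
  by move/leq_trans/(_ (size_Poly _)).
have constA i j : i \in A -> j \in A -> l i = l j by rewrite !inE => /eqP -> /eqP ->.
suff main (D : {set 'I_5}) : (forall i j, i \in D -> j \in D -> l i = l j) ->
    (forall i j, i \notin D -> j \notin D -> l i = l j) -> #|D| = 3%N ->
    exists s : 'S_5, exists r, [/\ forall k : 'I_5, (k < 3)%N -> l (s k) = r,
      l (s (inord 3)) = l (s (inord 4)) &
      ~ (X (s (inord 3)) = X (s (inord 4)) /\ Y (s (inord 3)) = Y (s (inord 4)))].
  have [i0 i0A] : exists i, i \in A by exists ord0; rewrite inE.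
  have B1 : (1 < #|(~: A)%SET|)%N.
    by apply: (@card_bound _ (l ord0)) => i; rewrite !inE negbK => /eqP.
  have [j jB] : exists j, j \in (~: A)%SET by apply/card_gt0P; exact: ltnW.
  have A1 : (1 < #|A|)%N.
    by apply: (@card_bound _ (l j)) => i iA; apply: constB => //; rewrite inE in jB.
  have cAB := cardsC A; rewrite card_ord in cAB.
  have [A3|A3] := eqVneq #|A| 3%N; first by apply: (main A).
  apply: (main (~: A)%SET).
  - by move=> i k; rewrite ![_ \in ~: A]inE; exact: constB.
  - by move=> i k; rewrite ![_ \in ~: A]inE !negbK; exact: constA.
  - by move/eqP: A3; move: A1 B1 cAB; move: #|A| #|(~: A)%SET| => a b; lia.
move=> D1 D2 D3; have [s [sk s3 s4]] := perm_split D3.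
exists s, (l (s ord0)); split; [|exact: D2|].
  by move=> k k3; apply: D1; exact: sk.
(* If the two remaining points coincided, all five would lie on a line and at one further point. *)
move=> [eX eY]; apply: (@not_line_and_point (l (s ord0)) (X (s (inord 3))) (Y (s (inord 3)))).
move=> i; rewrite -(permKV s i); set k := (s^-1)%g i.
have [k3|k3] := ltnP k 3; first by left; apply: D1; exact: sk.
right; have [->|->] : k = inord 3 \/ k = inord 4; last 2 first.
- by [].
- by rewrite eX eY.
case: k k3 => [[|[|[|[|[|]]]]] hk] //= _; [left|right]; apply: val_inj; by rewrite /= inordK.
Qed.

End UniqueConic.

(** * Self-motions *)

Section Limits.
Context {R : realType} {T : Type} {F : set_system T} {FF : Filter F}.
Implicit Types (f g : T -> 'cV[R]_3) (a b : 'cV[R]_3).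

Lemma cvg_entry m n (f : T -> 'M[R]_(m, n)) (l : 'M[R]_(m, n)) i j :
  f @ F --> l -> (fun x => f x i j) @ F --> l i j.
Proof.
move=> fl; apply: (@cvg_comp _ _ _ f (fun A : 'M[R]_(m, n) => A i j) _ _ _ fl).
exact: coord_continuous.
Qed.

Lemma cvg_dot f g a b : f @ F --> a -> g @ F --> b ->
  (fun x => dot (f x) (g x)) @ F --> dot a b.
Proof.
move=> fa gb; rewrite dotE; under eq_fun do rewrite dotE.
by apply: cvgD; [apply: cvgD|]; apply: cvgM; exact: cvg_entry.
Qed.

Lemma cvg_cross f g a b : f @ F --> a -> g @ F --> b ->
  (fun x => cross (f x) (g x)) @ F --> cross a b.
Proof.
move=> fa gb; apply: cvg_mx => i j; rewrite (ord1 j); move: i.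
by apply: ord3P; rewrite crossE; under eq_fun do rewrite crossE;
  apply: cvgB; apply: cvgM; exact: cvg_entry.
Qed.

Lemma cvg_mulmx (Q : T -> 'M[R]_3) (l : 'M[R]_3) (v : 'cV[R]_3) : Q @ F --> l ->
  (fun x => Q x *m v) @ F --> l *m v.
Proof.
move=> Ql; apply: cvg_mx => i j; rewrite mxE; under eq_fun do rewrite mxE.
rewrite !big_ord_recl big_ord0; under eq_fun do rewrite !big_ord_recl big_ord0.
by do 3![apply: cvgD; first by apply: cvgM; [exact: cvg_entry|exact: cvg_cst]]; exact: cvg_cst.
Qed.

Lemma cvg_addv f g a b : f @ F --> a -> g @ F --> b -> (fun x => f x + g x) @ F --> a + b.
Proof. exact: cvgD. Qed.

Lemma cvg_subv f g a b : f @ F --> a -> g @ F --> b -> (fun x => f x - g x) @ F --> a - b.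
Proof. exact: cvgB. Qed.

Lemma cvg_scalev c f a : f @ F --> a -> (fun x => c *: f x) @ F --> c *: a.
Proof.
move=> fa; apply: cvg_mx => i j; rewrite mxE; under eq_fun do rewrite mxE.
by apply: cvgM; [exact: cvg_cst|exact: cvg_entry].
Qed.

End Limits.

Lemma open_neq0 (R : realType) (T : topologicalType) (U : set T) (h : T -> R) : open U ->
  (forall u, U u -> {for u, continuous h}) -> open (U `&` [set u | h u != 0]).
Proof.
rewrite !openE => oU ch u [Uu hu]; rewrite /interior.
by apply: filterI; [exact: oU|exact: cvgr_neq0 (ch _ Uu) hu].
Qed.

Section SelfMotion.
Context {R : realType}.
Notation vec := 'cV[R]_3.
Variables (m M : 'I_5 -> vec) (o e1 e2 O E1 E2 : vec) (X Y : 'I_5 -> R) (C : 'rV[R]_6).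
Variables (r : 'I_5 -> R) (U : set 'rV[R]_2) (phi : 'rV[R]_2 -> pose R).
Hypothesis me : forall i, m i = o + X i *: e1 + Y i *: e2.
Hypothesis ME : forall i, M i = O + X i *: E1 + Y i *: E2.
Hypothesis oe : orthonormal2 e1 e2.
Hypothesis nE : cross E1 E2 != 0.
Hypothesis C0 : C != 0.
Hypothesis Cuniq : forall z, (forall i, quad z (X i) (Y i) = 0) -> exists l, z = l *: C.
Hypothesis motion : two_dim_self_motion m M r U phi.

Let Q u := (phi u).1.
Let w u := Q u *m o + (phi u).2 - O.
Let a u := Q u *m e1 - E1.
Let b u := Q u *m e2 - E2.

(* Coefficients of the squared leg length as a polynomial in the coordinates of
   the anchor points. *)
Definition leg_coefs u := coefs (dot (w u) (w u)) (2 * dot (w u) (a u)) (2 * dot (w u) (b u))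
  (dot (a u) (a u)) (2 * dot (a u) (b u)) (dot (b u) (b u)).
Local Notation z := leg_coefs.

Lemma leg_coefs_quad u i : U u -> quad (z u) (X i) (Y i) = r i ^+ 2.
Proof.
move=> Uu; have [_ [_ [_ [_ /(_ _ Uu) [_ /(_ i) <-]]]]] := motion.
rewrite edistE sqr_sqrtr ?dot_ge0 // quad_coefs.
have -> : Defs.act (phi u) (m i) - M i = w u + X i *: a u + Y i *: b u.
  rewrite /Defs.act me ME /w /a /b /Q !mulmxDr -!scalemxAr.
  by apply/matrixP => j k; rewrite !mxE; ring.
move: (w u) (a u) (b u) => w' a' b'.
by rewrite !dot_lin (dotC a' w') (dotC b' w') (dotC b' a'); ring.
Qed.

(** Leg lengths are constant along the motion, so the difference is a conic through the anchor
    points. *)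
Lemma leg_coefs_diff u v : U u -> U v -> exists l, z u - z v = l *: C.
Proof.
by move=> Uu Uv; apply: Cuniq => i; rewrite quadB !leg_coefs_quad // subrr.
Qed.

Lemma motion_rotation u : U u -> is_rotation (Q u).
Proof. by have [_ [_ [_ [_ h]]]] := motion => /h []. Qed.

Lemma motion_cvg u : U u -> phi @ u --> phi u.
Proof. by have [_ [_ [h _]]] := motion => /h. Qed.

Lemma cvg_Q u : U u -> Q @ u --> Q u.
Proof. by move=> Uu; apply: (@cvg_comp _ _ _ phi fst _ _ _ (motion_cvg Uu)); exact: cvg_fst. Qed.

Lemma cvg_w u : U u -> w @ u --> w u.
Proof.
move=> Uu; apply: (@cvg_subv _ _ (nbhs u)); last exact: cvg_cst.
apply: (@cvg_addv _ _ (nbhs u)); first by apply: (@cvg_mulmx _ _ (nbhs u)); exact: cvg_Q.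
by apply: (@cvg_comp _ _ _ phi snd _ _ _ (motion_cvg Uu)); exact: cvg_snd.
Qed.

Lemma cvg_a u : U u -> a @ u --> a u.
Proof.
move=> Uu; apply: (@cvg_subv _ _ (nbhs u)); last exact: cvg_cst.
by apply: (@cvg_mulmx _ _ (nbhs u)); exact: cvg_Q.
Qed.

Lemma cvg_b u : U u -> b @ u --> b u.
Proof.
move=> Uu; apply: (@cvg_subv _ _ (nbhs u)); last exact: cvg_cst.
by apply: (@cvg_mulmx _ _ (nbhs u)); exact: cvg_Q.
Qed.

(** Equal leg coefficients fix the lengths and the product of [a] and [b], hence the products of
    [E1], [E2] with the rotated frame that [finite_poses] asks for. The vectors [x] and [y] are left
    free because the generic and the degenerate case test [w] against different ones. *)
Lemma finite_fiber (F : set 'rV[R]_2) (x y : 'M[R]_3 -> vec) : F `<=` U ->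
  (forall u v, F u -> F v -> z u = z v) ->
  (forall u v, F u -> F v -> dot (w u) (x (Q u)) = dot (w v) (x (Q v))) ->
  (forall u v, F u -> F v -> dot (w u) (y (Q u)) = dot (w v) (y (Q v))) ->
  (forall u, F u -> cross (x (Q u)) (y (Q u)) != 0) -> finite_set F.
Proof.
move=> FU zF xF yF n0; have [->//|/set0P [v Fv]] := eqVneq F set0.
have [e11 e22 e12] := oe.
have zE u k : F u -> z u 0 (inord k) = z v 0 (inord k) by move=> Fu; rewrite (zF u v).
have rF u : F u -> is_rotation (Q u) by move=> /FU; exact: motion_rotation.
apply: (@finite_poses _ _ F Q w e1 e2 E1 E2 (dot E1 (Q v *m e1)) (dot E2 (Q v *m e2))
  (dot E1 (Q v *m e2) + dot E2 (Q v *m e1)) (dot (w v) (w v))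
  (dot (w v) (x (Q v))) (dot (w v) (y (Q v))) x y) => //.
- move=> u Fu; have := zE u 3 Fu; rewrite !mxE !inordK //= /a !dot_lin.
  by rewrite !dot_rotation ?e11 ?(dotC (_ *m _) E1); try exact: rF; lra.
- move=> u Fu; have := zE u 5 Fu; rewrite !mxE !inordK //= /b !dot_lin.
  by rewrite !dot_rotation ?e22 ?(dotC (_ *m _) E2); try exact: rF; lra.
- move=> u Fu; have := zE u 4 Fu; rewrite !mxE !inordK //= /a /b !dot_lin.
  by rewrite !dot_rotation ?e12 ?(dotC (_ *m _) E2); try exact: rF; lra.
- by move=> u Fu; have := zE u 0 Fu; rewrite !mxE !inordK.
- by move=> u Fu; exact: xF.
- by move=> u Fu; exact: yF.
- move=> u u' Fu Fu' eQ ew; have [_ [_ [_ [inj _]]]] := motion.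
  apply: inj; try exact: FU.
  have et : (phi u).2 = (phi u').2 by move: ew; rewrite /w eQ => /addIr /addrI.
  by rewrite [LHS]surjective_pairing [RHS]surjective_pairing et -/(Q u) eQ.
Qed.

Lemma cvg_leg_coefs j u : U u -> (fun u => z u 0 j) @ u --> z u 0 j.
Proof.
move=> Uu; have cw := cvg_w Uu; have ca := cvg_a Uu; have cb := cvg_b Uu; move: j.
have dbl f g (l l' : vec) : f @ u --> l -> g @ u --> l' ->
    (fun u => 2 * dot (f u) (g u)) @ u --> 2 * dot l l'.
  by move=> fl gl; apply: (@cvgM _ _ (nbhs u)); [exact: cvg_cst|exact: (@cvg_dot _ _ (nbhs u))].
have e i : (fun u => z u 0 i) = fun u => [:: dot (w u) (w u); 2 * dot (w u) (a u);
    2 * dot (w u) (b u); dot (a u) (a u); 2 * dot (a u) (b u); dot (b u) (b u)]`_i.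
  by apply/funext => v; rewrite mxE.
have sgl f g (l l' : vec) : f @ u --> l -> g @ u --> l' ->
    (fun u => dot (f u) (g u)) @ u --> dot l l'.
  by move=> fl gl; exact: (@cvg_dot _ _ (nbhs u)).
by apply: ord6P; rewrite mxE e inordK //=;
  [exact: (sgl _ _ _ _ cw cw)|exact: (dbl _ _ _ _ cw ca)|exact: (dbl _ _ _ _ cw cb)
  |exact: (sgl _ _ _ _ ca ca)|exact: (dbl _ _ _ _ ca cb)
  |exact: (sgl _ _ _ _ cb cb)].
Qed.

Lemma exists_coef : exists j, C 0 j != 0.
Proof.
apply/existsP; rewrite -negb_forall; apply: contra C0 => /forallP h.
by apply/eqP/rowP => j; rewrite mxE; apply/eqP.
Qed.

(** A coordinate in which [C] does not vanish is a parameter on the line of possible leg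
    coefficients. *)
Lemma leg_coefs_eq j u v : C 0 j != 0 -> U u -> U v -> z u 0 j = z v 0 j -> z u = z v.
Proof.
move=> Cj Uu Uv zj; apply/eqP; rewrite -subr_eq0; apply/eqP.
have [l e] := leg_coefs_diff Uu Uv; rewrite e.
have /eqP := congr1 (fun x : 'rV_6 => x 0 j) e.
rewrite [X in X == _]mxE [X in _ + X]mxE.
rewrite zj subrr mxE.
by rewrite eq_sym mulf_eq0 (negPf Cj) orbF => /eqP ->; rewrite scale0r.
Qed.

(* If [a] and [b] were independent, a pose would be determined up to finitely many
   possibilities by the parameter of the pencil spanned by the conic. *)
Lemma motion_dependent u : U u -> cross (a u) (b u) = 0.
Proof.
move=> Uu; apply/eqP; apply: contraT => n0.
(* Independence of [a] and [b] is the open condition that [h] is nonzero; the argument runs on that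
   open subset. *)
pose h u := dot (cross (a u) (b u)) (cross (a u) (b u)).
have ch v : U v -> {for v, continuous h}.
  move=> Uv; have cab := @cvg_cross _ _ (nbhs v) _ _ _ _ _ (cvg_a Uv) (cvg_b Uv).
  by apply: (@cvg_dot _ _ (nbhs v)); apply: cab.
have [oU _] := motion; have [j Cj] := exists_coef.
exfalso; apply: (@no_finite_fibers _ (U `&` [set u | h u != 0]) (fun u => z u 0 j)).
- exact: open_neq0.
- by exists u; split=> //=; rewrite /h dot_eq0.
- by move=> v [Uv _]; exact: cvg_leg_coefs.
- move=> c.
  have zF v v' : (U `&` [set u | h u != 0] `&` [set u | z u 0 j = c]) v ->
      (U `&` [set u | h u != 0] `&` [set u | z u 0 j = c]) v' -> z v = z v'.
    move=> [[Uv _] /= zv] [[Uv' _] /= zv'].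
    by apply: (leg_coefs_eq Cj) => //; rewrite zv zv'.
  apply: (@finite_fiber _ (fun q => q *m e1 - E1) (fun q => q *m e2 - E2)) => //.
  + by move=> v [[]].
  + move=> v v' Fv Fv'; have := congr1 (fun x : 'rV_6 => x 0 (inord 1)) (zF _ _ Fv Fv').
    by rewrite !mxE !inordK //= => /mulfI -> //; rewrite pnatr_eq0.
  + move=> v v' Fv Fv'; have := congr1 (fun x : 'rV_6 => x 0 (inord 2)) (zF _ _ Fv Fv').
    by rewrite !mxE !inordK //= => /mulfI -> //; rewrite pnatr_eq0.
  + by move=> v [[_]]; rewrite /= /h dot_eq0.
Qed.

(* The direction [(v1, v2)] is the kernel of [Q - A] at the given pose, and the
   conic is invariant under translations in this direction. *)
Lemma motion_kernel u0 : U u0 -> ~ (a u0 = 0 /\ b u0 = 0) ->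
  exists v1 v2, [/\ v1 ^+ 2 + v2 ^+ 2 != 0,
    C 0 (inord 1) * v1 + C 0 (inord 2) * v2 = 0,
    2 * C 0 (inord 3) * v1 + C 0 (inord 4) * v2 = 0,
    C 0 (inord 4) * v1 + 2 * C 0 (inord 5) * v2 = 0 &
    v1 *: a u0 + v2 *: b u0 = 0].
Proof.
move=> Uu0 ab0.
(* The vectors [a u0], [b u0] span a line: [(al, be)] selects a nonzero one of them, [(v1, v2)] is
   their linear relation, and [rho] completes the description of their Gram matrix of rank one. *)
have [al [be [v1 [v2 [rho [vn0 k0 va [rho0 za zab zb]]]]]]] :
    exists al be v1 v2 rho, [/\ v1 ^+ 2 + v2 ^+ 2 != 0, al *: a u0 + be *: b u0 != 0,
      v1 *: a u0 + v2 *: b u0 = 0 & [/\ 0 < rho, dot (a u0) (a u0) = rho * v2 ^+ 2,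
      dot (a u0) (b u0) = - rho * v1 * v2 & dot (b u0) (b u0) = rho * v1 ^+ 2]].
  move: (motion_dependent Uu0) ab0; move: (a u0) (b u0) => a' b' d ab0.
  have [a0|a0] := eqVneq a' 0.
    have b0 : b' != 0 by apply/eqP => b0; apply: ab0.
    exists 0, 1, 1, 0, (dot b' b'); split; last 1 [split].
    - by rewrite expr1n expr0n addr0 oner_eq0.
    - by rewrite scale0r scale1r add0r.
    - by rewrite a0 scaler0 scale0r addr0.
    - by rewrite dot_gt0.
    - by rewrite a0 dot0l; ring.
    - by rewrite a0 dot0l; ring.
    - by ring.
  have aa0 : dot a' a' != 0 by rewrite dot_eq0.
  pose mu := dot a' b' / dot a' a'.
  have e1' : mu * dot a' a' = dot a' b' by rewrite /mu divfK.
  have e2' : mu * dot a' b' = dot b' b'.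
    by apply: (mulfI aa0); rewrite -cross_eq0P // mulrA [_ * mu]mulrC e1' expr2.
  exists 1, 0, mu, (-1), (dot a' a'); split; last 1 [split].
  - by rewrite sqrrN expr1n gt_eqF // ltr_wpDl // sqr_ge0.
  - by rewrite scale1r scale0r addr0.
  - apply/eqP; rewrite -dot_eq0 !dot_lin (dotC b' a').
    apply/eqP; transitivity (mu * (mu * dot a' a' - dot a' b') - (mu * dot a' b' - dot b' b')).
      by ring.
    by rewrite e1' e2' !subrr mulr0 subr0.
  - by rewrite dot_gt0.
  - by ring.
  - by rewrite -e1'; ring.
  - by rewrite -e2' -e1'; ring.
pose k u := al *: a u + be *: b u.
(* The leg coefficients determine only the product of [w] with [k]; a direction [d] independent of
   [k] supplies the second product needed in [finite_fiber]. *)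
have [d kd0] : exists d, cross (k u0) d != 0.
  have [d [_ [[dd _ _] kd _]]] := exists_orthonormal k0.
  by exists d; rewrite -dot_eq0 dot_cross_cross kd dd mulr1 mul0r subr0 dot_eq0.
pose h u := dot (cross (k u) d) (cross (k u) d).
pose U' := U `&` [set u | h u != 0].
have ck v : U v -> k @ v --> k v.
  move=> Uv; apply: (@cvg_addv _ _ (nbhs v)); apply: (@cvg_scalev _ _ (nbhs v));
    [exact: cvg_a|exact: cvg_b].
have ch v : U v -> {for v, continuous h}.
  move=> Uv; have ckd := @cvg_cross _ _ (nbhs v) _ _ _ _ _ (ck _ Uv) (cvg_cst d).
  by apply: (@cvg_dot _ _ (nbhs v)); apply: ckd.
have [oU _] := motion; have [j Cj] := exists_coef.
(* The parameter on the line of leg coefficients: [z u] is [z u0] plus [lam u] times [C]. *)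
pose lam u := (z u 0 j - z u0 0 j) / C 0 j.
have zlam u i : U u -> z u 0 i = z u0 0 i + lam u * C 0 i.
  move=> Uu; have [l e] := leg_coefs_diff Uu Uu0.
  have en n : z u 0 n - z u0 0 n = l * C 0 n.
    by have := congr1 (fun x : 'rV_6 => x 0 n) e; rewrite [LHS]mxE [X in _ + X]mxE [RHS]mxE.
  by rewrite /lam en mulfK // -en addrC subrK.
(* If [lam] took finitely many values, the continuous function [dot (w u) d] would have finite
   fibres on [U']. So no nonzero polynomial vanishes on all values of [lam]. *)
have nolam (p : {poly R}) : p != 0 -> (forall u, U' u -> root p (lam u)) -> False.
  move=> p0 rp; apply: (@no_finite_fibers _ U' (fun u => dot (w u) d)).
  - exact: open_neq0.
  - by exists u0; split=> //=; rewrite /h dot_eq0.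
  - by move=> v [Uv _]; apply: (@cvg_dot _ _ (nbhs v)); [exact: cvg_w|exact: cvg_cst].
  - move=> c; apply: (finite_fibers_root p0 (g := lam)) => [u [U'u _]|c']; first exact: rp.
    set F := _ `&` _.
    have FU u : F u -> U u by move=> [[[]]].
    have zF u v : F u -> F v -> z u = z v.
      move=> Fu Fv; apply/rowP => i; rewrite (zlam u _ (FU _ Fu)) (zlam v _ (FU _ Fv)).
      by case: Fu => _ /= ->; case: Fv => _ /= ->.
    apply: (@finite_fiber F (fun q => al *: (q *m e1 - E1) + be *: (q *m e2 - E2))
      (fun=> d)) => //.
    + move=> u v Fu Fv; rewrite !dotDr !dotZr -/(a u) -/(b u) -/(a v) -/(b v).
      have := congr1 (fun x : 'rV_6 => x 0 (inord 1)) (zF _ _ Fu Fv).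
      have := congr1 (fun x : 'rV_6 => x 0 (inord 2)) (zF _ _ Fu Fv).
      have two0 : 2 != 0 :> R by rewrite pnatr_eq0.
      by rewrite !mxE !inordK //= => /(mulfI two0) -> /(mulfI two0) ->.
    + by move=> u v [[_ /= ->] _] [[_ /= ->] _].
    + by move=> u [[[_]]]; rewrite /= /h dot_eq0.
have [u1 [Uu1 _] lam1] : exists2 u1, U' u1 & lam u1 != 0.
  apply: contrapT => no; apply: (nolam 'X); first by rewrite polyX_eq0.
  move=> u Uu; rewrite /root hornerX; apply: contraT => l0.
  by case: no; exists u.
pose z0 := z u0.
have z03 : z0 0 (inord 3) = rho * v2 ^+ 2 by rewrite mxE inordK.
have z04 : z0 0 (inord 4) = - 2 * rho * v1 * v2 by rewrite mxE inordK //= zab; ring.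
have z05 : z0 0 (inord 5) = rho * v1 ^+ 2 by rewrite mxE inordK.
(* Dependence of [a] and [b] makes the discriminant of the quadratic part vanish for every [lam].
   Its constant term is zero by the choice of [v1], [v2], and its linear coefficient is [4 * rho]
   times the left side here. *)
have Cv : C 0 (inord 3) * v1 ^+ 2 + C 0 (inord 4) * v1 * v2 + C 0 (inord 5) * v2 ^+ 2 = 0.
  apply: contrapT => Cv.
  pose p := Poly [:: 0; 4 * rho * (C 0 (inord 3) * v1 ^+ 2 + C 0 (inord 4) * v1 * v2
     + C 0 (inord 5) * v2 ^+ 2); 4 * C 0 (inord 3) * C 0 (inord 5) - C 0 (inord 4) ^+ 2].
  apply: (nolam p).
    apply/eqP => /(congr1 (fun q : {poly R} => q`_1)).
    rewrite coef_Poly coef0 /= => /eqP; rewrite !mulf_eq0 pnatr_eq0 /= gt_eqF //=.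
    by move/eqP.
  move=> u [Uu _]; rewrite /root /p horner_Poly /=; apply/eqP.
  have := cross_eq0P (motion_dependent Uu).
  have := zlam u (inord 3) Uu; have := zlam u (inord 4) Uu; have := zlam u (inord 5) Uu.
  rewrite -/z0 z03 z04 z05 !mxE !inordK //=.
  move: (dot (a u) (a u)) (dot (a u) (b u)) (dot (b u) (b u)) => aa ab bb -> e -> sq.
  transitivity (4 * ((rho * v2 ^+ 2 + lam u * C 0 (inord 3)) *
    (rho * v1 ^+ 2 + lam u * C 0 (inord 5))) - (2 * ab) ^+ 2); first by rewrite e; ring.
  by rewrite -sq; ring.
(* Passing from [u0] to [u1] changes the squared length of [v1 *: a + v2 *: b] by [lam u1] times the
   expression in [Cv], so it remains zero. *)
have va1 : v1 *: a u1 + v2 *: b u1 = 0.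
  apply/eqP; rewrite -dot_eq0; apply/eqP.
  have := zlam u1 (inord 3) Uu1; have := zlam u1 (inord 4) Uu1; have := zlam u1 (inord 5) Uu1.
  rewrite -/z0 z03 z04 z05 !mxE !inordK //=.
  move: (a u1) (b u1) => a' b' hb hab ha; rewrite !dot_lin (dotC b' a').
  transitivity (v1 ^+ 2 * dot a' a' + v1 * v2 * (2 * dot a' b') + v2 ^+ 2 * dot b' b').
    by ring.
  rewrite hb hab ha; transitivity (lam u1 * (C 0 (inord 3) * v1 ^+ 2
    + C 0 (inord 4) * v1 * v2 + C 0 (inord 5) * v2 ^+ 2)); first by ring.
  by rewrite Cv mulr0.
(* Each required relation holds for the leg coefficients at [u0] and at [u1], hence for their
   difference, a nonzero multiple of [C]. *)
have lin i i' x y (f : 'rV[R]_2 -> vec) :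
    (forall u, x * z u 0 i * v1 + y * z u 0 i' * v2 = 2 * dot (f u) (v1 *: a u + v2 *: b u)) ->
    x * C 0 i * v1 + y * C 0 i' * v2 = 0.
  move=> hl; apply: (mulfI lam1); rewrite mulr0.
  have := hl u1; have := hl u0; rewrite va va1 !dot0r mulr0 !(zlam u1) // => h0 h1.
  transitivity ((x * (z u0 0 i + lam u1 * C 0 i) * v1 + y * (z u0 0 i' + lam u1 * C 0 i') * v2)
    - (x * z u0 0 i * v1 + y * z u0 0 i' * v2)); first by ring.
  by rewrite h0 h1 subrr.
exists v1, v2; split=> //.
- rewrite -[C 0 _]mul1r -[X in _ + X * _]mul1r; apply: (lin _ _ _ _ w) => u.
  rewrite !mxE !inordK //=; move: (w u) (a u) (b u) => w' a' b'.
  by rewrite !dot_lin; ring.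
- rewrite -[X in _ + X * _]mul1r; apply: (lin _ _ _ _ a) => u.
  rewrite !mxE !inordK //=; move: (w u) (a u) (b u) => w' a' b'.
  by rewrite !dot_lin; ring.
- rewrite -[C 0 (inord 4)]mul1r; apply: (lin _ _ _ _ b) => u.
  rewrite !mxE !inordK //=; move: (a u) (b u) => a' b'.
  by rewrite !dot_lin (dotC b' a'); ring.
Qed.

End SelfMotion.

(** * Construction of Schoenflies motions *)

Section MoreLimits.
Context {R : realType} {T : Type} {F : set_system T} {FF : Filter F}.
Implicit Types (f g h : T -> R) (a b c : R).

Lemma cvg_sqrt f a : f @ F --> a -> (fun x => Num.sqrt (f x)) @ F --> Num.sqrt a.
Proof.
move=> fa; apply: (@cvg_comp _ _ _ f Num.sqrt _ _ _ fa); exact: sqrt_continuous.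
Qed.

Definition vec3 a b c : 'cV[R]_3 := \col_i [:: a; b; c]`_i.

Lemma cvg_vec3 f g h a b c : f @ F --> a -> g @ F --> b -> h @ F --> c ->
  (fun x => vec3 (f x) (g x) (h x)) @ F --> vec3 a b c.
Proof.
move=> fa gb hc; apply: cvg_mx => i j; rewrite mxE; under eq_fun do rewrite mxE.
by case: i => [[|[|[|]]]].
Qed.

Lemma cvg_scale f a (g : T -> 'cV[R]_3) (b : 'cV[R]_3) : f @ F --> a -> g @ F --> b ->
  (fun x => f x *: g x) @ F --> a *: b.
Proof.
move=> fa gb; apply: cvg_mx => i j; rewrite mxE; under eq_fun do rewrite mxE.
by apply: cvgM => //; exact: cvg_entry.
Qed.

Lemma cvg_frame_rot (a b : 'cV[R]_3) (f g : T -> 'cV[R]_3) (u v : 'cV[R]_3) :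
  f @ F --> u -> g @ F --> v ->
  (fun x => frame_rot a b (f x) (g x)) @ F --> frame_rot a b u v.
Proof.
move=> fu gv; have cr := @cvg_cross _ _ F FF _ _ _ _ fu gv.
have cc : (fun x => col3 (f x) (g x) (cross (f x) (g x))) @ F --> col3 u v (cross u v).
  apply: cvg_mx => i j; rewrite mxE; under eq_fun do rewrite mxE.
  by case: j => [[|[|[|]]]] //= _; [exact: (cvg_entry fu)|exact: (cvg_entry gv)|
    exact: (cvg_entry cr)].
apply: cvg_mx => i j; rewrite mxE !big_ord_recl big_ord0.
under eq_fun do rewrite mxE !big_ord_recl big_ord0.
do 3![apply: cvgD; first by apply: cvgM; [exact: (cvg_entry cc)|exact: cvg_cst]].
exact: cvg_cst.
Qed.

Lemma cvg_pose (f : T -> 'M[R]_3) (g : T -> 'cV[R]_3) (Q : 'M[R]_3) (t : 'cV[R]_3) :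
  f @ F --> Q -> g @ F --> t -> (fun x => (f x, g x) : pose R) @ F --> ((Q, t) : pose R).
Proof.
move=> fQ gt.
exact: (@cvg_pair T _ _ F (nbhs Q) (nbhs t) FF (nbhs_filter Q) (nbhs_filter t) f g fQ gt).
Qed.

End MoreLimits.

Lemma frame_rot1 (R : realType) (a b u v : 'cV[R]_3) : orthonormal2 a b ->
  frame_rot a b u v *m a = u.
Proof.
move=> [aa bb ab]; rewrite frame_rotE aa (dotC b) ab (dotC (cross _ _)) dot_crossl.
by rewrite !scale0r scale1r !addr0.
Qed.

Lemma frame_rot2 (R : realType) (a b u v : 'cV[R]_3) : orthonormal2 a b ->
  frame_rot a b u v *m b = v.
Proof.
move=> [aa bb ab]; rewrite frame_rotE ab bb (dotC (cross _ _)) dot_crossr.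
by rewrite !scale0r scale1r addr0 add0r.
Qed.

(* The rotation about the direction of the strip has sine [S], [strip_B] is the vector
   [Q u - A u] across the strip (of width [y1]) and [strip_w] runs on the circle of
   points at distance [sqrt rho] both from [0] and from [- y1 *: strip_B], with parameter [t]. *)
Section Strip.
Context {R : realType}.
Notation vec := 'cV[R]_3.
Variables (v u F1 F2 : vec) (cc d y1 : R).
Hypothesis ovu : orthonormal2 v u.
Hypothesis oF : orthonormal2 F1 F2.
Let F3 := cross F1 F2.

Definition strip_dir S := Num.sqrt (1 - S ^+ 2) *: F2 + S *: F3.
Definition strip_rot S := frame_rot v u F1 (strip_dir S).
Definition strip_B S := strip_dir S - (cc *: F1 + d *: F2).
(** The component of [strip_B S] orthogonal to [F1], turned about [F1] by a right angle; it is thus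
    orthogonal to [strip_B S], and nonzero for positive [S]. *)
Definition strip_p S := (Num.sqrt (1 - S ^+ 2) - d) *: F3 - S *: F2.
Definition strip_n S := cross (strip_B S) (strip_p S).
(** The squared common leg length, large enough for the radicand in [strip_h] to be nonnegative when
    [0 < S < 1] and [t ^+ 2 <= 1]; [3 + 2 * d ^+ 2] bounds the squared length of [strip_p S]. *)
Definition strip_rho := y1 ^+ 2 * (cc ^+ 2 + (3 + 2 * d ^+ 2)) + (3 + 2 * d ^+ 2) + 1.
Definition strip_h S t := Num.sqrt ((strip_rho - y1 ^+ 2 / 4 * dot (strip_B S) (strip_B S)
  - t ^+ 2 * dot (strip_p S) (strip_p S)) / dot (strip_n S) (strip_n S)).
Definition strip_w S t := (- (y1 / 2)) *: strip_B S + t *: strip_p S + strip_h S t *: strip_n S.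

Lemma strip_dots : [/\ dot F1 F1 = 1, dot F2 F2 = 1, dot F3 F3 = 1 &
  [/\ dot F1 F2 = 0, dot F1 F3 = 0, dot F2 F3 = 0, dot F2 F1 = 0 &
      dot F3 F1 = 0 /\ dot F3 F2 = 0]].
Proof.
have [h1 h2 h3] := oF; have h4 := orthonormal_cross oF.
have h5 := dot_crossl F1 F2; have h6 := dot_crossr F1 F2.
do ! split => //; by rewrite dotC.
Qed.

Section Fixed.
Variables (S t : R).
Hypothesis S01 : 0 < S < 1.
Hypothesis t1 : t ^+ 2 <= 1.
Let c0 := Num.sqrt (1 - S ^+ 2).

Lemma strip_cos : c0 ^+ 2 = 1 - S ^+ 2.
Proof. by rewrite sqr_sqrtr //; case/andP: S01 => h1 h2; nra. Qed.

Lemma strip_dir_orthonormal : orthonormal2 F1 (strip_dir S).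
Proof.
have [h1 h2 h3 [h4 h5 h6 h7 [h8 h9]]] := strip_dots.
rewrite /strip_dir; split=> //; rewrite !dot_lin ?h2 ?h3 ?h4 ?h5 ?h6 ?h9; last by ring.
by have := strip_cos; rewrite /c0; move: (Num.sqrt _) => C; lra.
Qed.

Lemma strip_dir_F3 : dot (strip_dir S) F3 = S.
Proof.
have [h1 h2 h3 [h4 h5 h6 h7 [h8 h9]]] := strip_dots.
by rewrite /strip_dir !dot_lin h3 h6; ring.
Qed.

Lemma strip_pp : dot (strip_p S) (strip_p S) = (c0 - d) ^+ 2 + S ^+ 2.
Proof.
have [h1 h2 h3 [h4 h5 h6 h7 [h8 h9]]] := strip_dots.
by rewrite /strip_p !dot_lin h2 h3 h6 h9 /c0; ring.
Qed.

Lemma strip_BB : dot (strip_B S) (strip_B S) = cc ^+ 2 + dot (strip_p S) (strip_p S).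
Proof.
have [h1 h2 h3 [h4 h5 h6 h7 [h8 h9]]] := strip_dots.
by rewrite strip_pp /strip_B /strip_dir !dot_lin h1 h2 h3 h4 h5 h6 h7 h8 h9 /c0; ring.
Qed.

Lemma strip_Bp : dot (strip_B S) (strip_p S) = 0.
Proof.
have [h1 h2 h3 [h4 h5 h6 h7 [h8 h9]]] := strip_dots.
by rewrite /strip_p /strip_B /strip_dir !dot_lin h2 h3 h4 h5 h6 h9; ring.
Qed.

Lemma strip_pp_gt0 : 0 < dot (strip_p S) (strip_p S).
Proof.
rewrite strip_pp ltr_wpDl ?sqr_ge0 // exprn_gt0 //.
by case/andP: S01.
Qed.

Lemma strip_nn_gt0 : 0 < dot (strip_n S) (strip_n S).
Proof.
rewrite /strip_n dot_cross_cross strip_Bp mul0r subr0 mulr_gt0 ?strip_pp_gt0 //.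
by rewrite strip_BB ltr_wpDl ?sqr_ge0 ?strip_pp_gt0.
Qed.

Lemma strip_radicand : 0 <= strip_rho - y1 ^+ 2 / 4 * dot (strip_B S) (strip_B S)
  - t ^+ 2 * dot (strip_p S) (strip_p S).
Proof.
have hP : dot (strip_p S) (strip_p S) <= 3 + 2 * d ^+ 2.
  rewrite strip_pp; have := strip_cos; have := sqr_ge0 (c0 + d); have := sqr_ge0 S.
  by case/andP: S01 => ? ?; move: c0 => C; nra.
have P0 := ltW strip_pp_gt0; rewrite strip_BB /strip_rho.
move: (dot (strip_p S) (strip_p S)) hP P0 => q hq q0.
have h1 : t ^+ 2 * q <= q by rewrite ler_piMl.
have h2 : y1 ^+ 2 / 4 * (cc ^+ 2 + q) <= y1 ^+ 2 * (cc ^+ 2 + (3 + 2 * d ^+ 2)).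
  have := sqr_ge0 y1; have := sqr_ge0 cc; move: (y1 ^+ 2) (cc ^+ 2) (d ^+ 2) hq => Y D E hq D0 Y0.
  apply: ler_pM => //; nra.
by lra.
Qed.

Lemma strip_hh : strip_h S t ^+ 2 * dot (strip_n S) (strip_n S) =
  strip_rho - y1 ^+ 2 / 4 * dot (strip_B S) (strip_B S) - t ^+ 2 * dot (strip_p S) (strip_p S).
Proof.
rewrite /strip_h sqr_sqrtr; last by rewrite divr_ge0 ?strip_radicand ?dot_ge0.
by rewrite divfK // gt_eqF // strip_nn_gt0.
Qed.

(** The vectors B, p, n are mutually orthogonal, and the coefficient of B is [y - y1 / 2], with the
    same square at both values of [y]. The height [strip_h] supplies the remaining length. *)
Lemma strip_leg y : y = 0 \/ y = y1 ->
  dot (strip_w S t + y *: strip_B S) (strip_w S t + y *: strip_B S) = strip_rho.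
Proof.
have hh := strip_hh; have Bp := strip_Bp; have nB := dot_crossl (strip_B S) (strip_p S).
have np := dot_crossr (strip_B S) (strip_p S).
rewrite -/(strip_n S) in nB np; rewrite /strip_w.
move: (strip_h S t) hh nB np Bp; move: (strip_B S) (strip_p S) (strip_n S).
move=> B p n h hh nB np Bp hy.
rewrite !dot_lin (dotC p B) (dotC n B) (dotC n p) nB np Bp.
transitivity ((y - y1 / 2) ^+ 2 * dot B B + t ^+ 2 * dot p p + h ^+ 2 * dot n n).
  by ring.
by rewrite hh; case: hy => ->; field.
Qed.

(** Since [strip_p S] is nonzero, this recovers [t] from the translation and gives injectivity of
    the motion. *)
Lemma strip_w_p : dot (strip_w S t) (strip_p S) = t * dot (strip_p S) (strip_p S).
Proof.
have Bp := strip_Bp; have np := dot_crossr (strip_B S) (strip_p S).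
rewrite -/(strip_n S) in np; rewrite /strip_w.
move: (strip_B S) (strip_p S) (strip_n S) Bp np (strip_h S t) => B p n Bp np h.
by rewrite !dot_lin (dotC n p) np Bp; ring.
Qed.

End Fixed.

Section Limit.
Context {T : Type} {F : set_system T} {FF : Filter F}.
Variables (f g : T -> R) (S t : R).
Hypothesis fS : f @ F --> S.
Hypothesis gt : g @ F --> t.
Hypothesis S01 : 0 < S < 1.

Let cvg_cos : (fun x => Num.sqrt (1 - f x ^+ 2)) @ F --> Num.sqrt (1 - S ^+ 2).
Proof. by apply: cvg_sqrt; apply: cvgB; [exact: cvg_cst|exact: cvgM]. Qed.

Let cvg_dir : (fun x => strip_dir (f x)) @ F --> strip_dir S.
Proof. by apply: cvg_addv; apply: cvg_scale => //; exact: cvg_cst. Qed.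

Lemma cvg_strip_rot : (fun x => strip_rot (f x)) @ F --> strip_rot S.
Proof. by apply: cvg_frame_rot; [exact: cvg_cst|exact: cvg_dir]. Qed.

Let cvg_B : (fun x => strip_B (f x)) @ F --> strip_B S.
Proof. by apply: cvg_subv; [exact: cvg_dir|exact: cvg_cst]. Qed.

Let cvg_p : (fun x => strip_p (f x)) @ F --> strip_p S.
Proof.
apply: cvg_subv; last by apply: cvg_scale => //; exact: cvg_cst.
by apply: cvg_scale; [apply: cvgB; [exact: cvg_cos|exact: cvg_cst]|exact: cvg_cst].
Qed.

Let cvg_n : (fun x => strip_n (f x)) @ F --> strip_n S.
Proof. by apply: cvg_cross; [exact: cvg_B|exact: cvg_p]. Qed.

Lemma cvg_strip_w : (fun x => strip_w (f x) (g x)) @ F --> strip_w S t.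
Proof.
have cBB : (fun x => dot (strip_B (f x)) (strip_B (f x))) @ F --> dot (strip_B S) (strip_B S).
  exact: (@cvg_dot _ _ F FF _ _ _ _ cvg_B cvg_B).
have cpp : (fun x => dot (strip_p (f x)) (strip_p (f x))) @ F --> dot (strip_p S) (strip_p S).
  exact: (@cvg_dot _ _ F FF _ _ _ _ cvg_p cvg_p).
have cnn : (fun x => dot (strip_n (f x)) (strip_n (f x))) @ F --> dot (strip_n S) (strip_n S).
  exact: (@cvg_dot _ _ F FF _ _ _ _ cvg_n cvg_n).
apply: cvg_addv; first apply: cvg_addv.
- by apply: cvg_scale; [exact: cvg_cst|exact: cvg_B].
- by apply: cvg_scale; [exact: gt|exact: cvg_p].
- apply: cvg_scale; last exact: cvg_n.
  apply: cvg_sqrt; apply: cvgM.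
    apply: cvgB; last by apply: cvgM; [apply: cvgM|exact: cpp].
    by apply: cvgB; [exact: cvg_cst|apply: cvgM; [exact: cvg_cst|exact: cBB]].
  by apply: cvgV; [rewrite gt_eqF // strip_nn_gt0|exact: cnn].
Qed.

End Limit.
End Strip.

(** * Planar affine pentapods *)

Section PlanarAffine.
Context {R : realType}.
Notation vec := 'cV[R]_3.
Variables (m M : 'I_5 -> vec) (n : vec) (c : R) (f : vec -> vec) (A : 'M[R]_3) (b : vec).
Hypothesis n0 : n != 0.
Hypothesis mP : forall i, plane n c (m i).
Hypothesis fA : forall x, plane n c x -> f x = A *m x + b.
Hypothesis finj : forall x y, plane n c x -> plane n c y -> f x = f y -> x = y.
Hypothesis fM : forall i, f (m i) = M i.

Lemma plane_sub x y : plane n c x -> plane n c y -> dot n (x - y) = 0.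
Proof. by rewrite /plane /= => hx hy; rewrite dotDr dotNr hx hy subrr. Qed.

Lemma plane_add x v : plane n c x -> dot n v = 0 -> plane n c (x + v).
Proof. by rewrite /plane /= => hx hv; rewrite dotDr hx hv addr0. Qed.

Lemma affine_sub x y : plane n c x -> plane n c y -> f x - f y = A *m (x - y).
Proof. by move=> hx hy; rewrite !fA // mulmxBr opprD addrACA subrr addr0. Qed.

Lemma affine_inj v : dot n v = 0 -> A *m v = 0 -> v = 0.
Proof.
move=> nv Av; have hx := mP ord0; have hy := plane_add hx nv.
have /addrI : m ord0 + v = m ord0 + 0.
  rewrite addr0; apply: finj => //; apply/eqP; rewrite -subr_eq0 affine_sub //.
  by rewrite addrAC subrr add0r Av.
by [].
Qed.

Lemma plane_expand e1 e2 x : orthonormal2 e1 e2 -> dot n e1 = 0 -> dot n e2 = 0 ->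
  dot n x = 0 -> x = dot x e1 *: e1 + dot x e2 *: e2.
Proof.
move=> o n1 n2 nx; rewrite {1}(orthonormal_expand x o).
have en : n = dot n (cross e1 e2) *: cross e1 e2.
  by rewrite {1}(orthonormal_expand n o) n1 n2 !scale0r !add0r.
move: nx; rewrite en dotZl (dotC _ x) => /eqP; rewrite mulf_eq0 => /orP[/eqP h|/eqP ->].
  by case/eqP: n0; rewrite en h scale0r.
by rewrite scale0r addr0.
Qed.

Lemma affine_frame e1 e2 : orthonormal2 e1 e2 -> dot n e1 = 0 -> dot n e2 = 0 ->
  cross (A *m e1) (A *m e2) != 0.
Proof.
move=> [e11 e22 e12] n1 n2; apply: cross_indep_neq0 => x y.
rewrite !scalemxAr -mulmxDr => /affine_inj h.
have {}h : x *: e1 + y *: e2 = 0 by apply: h; rewrite !dot_lin n1 n2 !mulr0 addr0.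
have := congr1 (dot e1) h; have := congr1 (dot e2) h.
by rewrite !dot_lin !dot0r e11 e22 (dotC e2) e12 !mulr0 !mulr1 addr0 add0r.
Qed.

Lemma anchor_coords e1 e2 i0 : orthonormal2 e1 e2 -> dot n e1 = 0 -> dot n e2 = 0 ->
  (forall i, m i = m i0 + dot (m i - m i0) e1 *: e1 + dot (m i - m i0) e2 *: e2) /\
  (forall i, M i = M i0 + dot (m i - m i0) e1 *: (A *m e1) + dot (m i - m i0) e2 *: (A *m e2)).
Proof.
move=> o n1 n2.
have h i : m i - m i0 = dot (m i - m i0) e1 *: e1 + dot (m i - m i0) e2 *: e2.
  by apply: plane_expand => //; exact: plane_sub.
split=> i; first by rewrite -addrA -h addrC subrK.
by rewrite !scalemxAr -addrA -mulmxDr -h -affine_sub // !fM addrC subrK.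
Qed.

Lemma edist_eq (x y x' y' : vec) :
  dot (x - y) (x - y) = dot (x' - y') (x' - y') -> Defs.edist x y = Defs.edist x' y'.
Proof. by rewrite !edistE => ->. Qed.

Lemma edist_eq_dot (x y x' y' : vec) : Defs.edist x y = Defs.edist x' y' ->
  dot (x - y) (x - y) = dot (x' - y') (x' - y').
Proof. by rewrite !edistE => /(congr1 (fun t => t ^+ 2)); rewrite !sqr_sqrtr ?dot_ge0. Qed.

(** By injectivity of [A] on plane directions, points whose images differ by [k *: (A *m d)] differ
    by [k *: d], a vector of the same length. *)
Lemma congruent_on_parallel (S : set vec) (d : vec) : S `<=` plane n c -> dot n d = 0 ->
  dot (A *m d) (A *m d) = dot d d ->
  (forall x y, S x -> S y -> exists k, f x - f y = k *: (A *m d)) -> congruent_on S f.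
Proof.
move=> SP nd dd h x y Sx Sy; apply: edist_eq.
have [k e] := h x y Sx Sy; have Px := SP _ Sx; have Py := SP _ Sy.
have exy : x - y = k *: d.
  apply/eqP; rewrite -subr_eq0; apply/eqP/affine_inj.
    by rewrite dotDr dotNr plane_sub // dotZr nd mulr0 subrr.
  by rewrite mulmxBr -affine_sub // e scalemxAr subrr.
by rewrite e exy !dotZl !dotZr dd.
Qed.

Lemma motion_cases r U phi : ~ arch_singular m M -> two_dim_self_motion m M r U phi ->
  (congruent_on (plane n c) f /\ pure_translation U phi) \/
  (exists s : 'S_5, case2 m M (plane n c) f s /\
     schoenflies U phi (m (s (inord 4)) - m (s (inord 3)))
                       (M (s (inord 4)) - M (s (inord 3)))).
Proof.
move=> ns motion.
have [e1 [e2 [oe n1 n2]]] := exists_orthonormal n0.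
have [me ME] := anchor_coords ord0 oe n1 n2.
pose X i := dot (m i - m ord0) e1; pose Y i := dot (m i - m ord0) e2.
have nE := affine_frame oe n1 n2.
have [C [C0 CXY Cuniq]] := unique_conic me ME ns.
have [_ [[u0 Uu0] _]] := motion.
pose a u := (phi u).1 *m e1 - A *m e1; pose bb u := (phi u).1 *m e2 - A *m e2.
have rot u : U u -> is_rotation (phi u).1 by exact: (motion_rotation motion).
(* Either every rotation agrees with [A] on the plane directions, which gives the translation case,
   or some pose has a proper kernel direction. *)
have [ab0|/existsNP [u1 /not_implyP [Uu1 ab1]]] :=
    pselect (forall u, U u -> a u = 0 /\ bb u = 0).
  have QA u x : U u -> dot n x = 0 -> (phi u).1 *m x = A *m x.
    move=> Uu nx; rewrite (plane_expand oe n1 n2 nx) !mulmxDr -!scalemxAr.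
    by have [/eqP + /eqP] := ab0 u Uu; rewrite !subr_eq0 => /eqP -> /eqP ->.
  left; split=> [x y Px Py|u v Uu Uv].
    apply: edist_eq; rewrite affine_sub // -(QA u0) // ?dot_rotation //; first exact: rot.
    exact: plane_sub.
  apply: (rotation_eq (u := e1) (v := e2)); try exact: rot.
  - exact: orthonormal_cross_neq0.
  - by rewrite !QA.
  - by rewrite !QA.
have ker := @motion_kernel _ _ _ _ _ _ _ _ _ _ _ _ _ _ _ me ME oe nE C0 Cuniq motion.
have [v1 [v2 [vn K1 K2 K3 va]]] := ker _ Uu1 ab1.
pose v := v1 *: e1 + v2 *: e2.
have nv : dot n v = 0 by rewrite !dot_lin n1 n2 !mulr0 addr0.
(* The kernel direction found at [u1] serves at every pose, as the kernel direction of any other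
   pose is parallel to it. *)
have Qv u : U u -> (phi u).1 *m v = A *m v.
  move=> Uu; apply/eqP; rewrite -subr_eq0 /v !mulmxDr -!scalemxAr opprD addrACA -!scalerBr.
  rewrite -/(a u) -/(bb u); apply/eqP.
  have [[-> ->]|ab] := pselect (a u = 0 /\ bb u = 0); first by rewrite !scaler0 addr0.
  have [v1' [v2' [vn' K1' K2' K3' va']]] := ker _ Uu ab.
  rewrite -/(a u) -/(bb u) in va'.
  (* A conic invariant in two independent directions is constant, and the constant is zero because
     an anchor point lies on it. *)
  have par : v1 * v2' = v2 * v1'.
    apply/eqP; apply: contraT => np.
    have det0 x y : x * v1 + y * v2 = 0 -> x * v1' + y * v2' = 0 -> x = 0 /\ y = 0.
      move=> h1 h2; have np' : v1 * v2' - v2 * v1' != 0 by rewrite subr_eq0.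
      split; apply: (mulIf np'); rewrite mul0r.
        transitivity ((x * v1 + y * v2) * v2' - (x * v1' + y * v2') * v2); first by ring.
        by rewrite h1 h2 !mul0r subrr.
      transitivity ((x * v1' + y * v2') * v1 - (x * v1 + y * v2) * v1'); first by ring.
      by rewrite h1 h2 !mul0r subrr.
    have [c1 c2] := det0 _ _ K1 K1'; have [c3 c4] := det0 _ _ K2 K2'.
    have [_ c5] := det0 _ _ K3 K3'.
    have {}c3 : C 0 (inord 3) = 0 by lra.
    have {}c5 : C 0 (inord 5) = 0 by lra.
    have := CXY ord0; rewrite quadE c1 c2 c3 c4 c5 !mul0r !addr0 => c0.
    case/negP: C0; apply/eqP/rowP.
    by apply: ord6P; rewrite mxE.
  set y := _ + _.
  have y1 : v1' *: y = 0.
    transitivity (v1 *: (v1' *: a u + v2' *: bb u)); last by rewrite va' scaler0.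
    by rewrite /y !scalerDr !scalerA par (mulrC v1') (mulrC v2).
  have y2 : v2' *: y = 0.
    transitivity (v2 *: (v1' *: a u + v2' *: bb u)); last by rewrite va' scaler0.
    by rewrite /y !scalerDr !scalerA -par (mulrC v2') (mulrC v2').
  have /eqP : (v1' ^+ 2 + v2' ^+ 2) *: y = 0.
    by rewrite scalerDl !expr2 -!scalerA y1 y2 !scaler0 addr0.
  by rewrite scaler_eq0 (negPf vn') => /eqP.
have Avv : dot (A *m v) (A *m v) = dot v v by rewrite -(Qv u0) // dot_rotation //; exact: rot.
have [s [r0 [s3 s34 sneq]]] := three_two_split C0 CXY Cuniq vn K1 K2 K3.
pose l i := v2 * X i - v1 * Y i.
have par i j : l i = l j -> exists k, m i - m j = k *: v.
  move=> lij; exists ((v1 * (X i - X j) + v2 * (Y i - Y j)) / (v1 ^+ 2 + v2 ^+ 2)).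
  transitivity ((X i - X j) *: e1 + (Y i - Y j) *: e2).
    rewrite {1}me {1}(me j) -/(X i) -/(X j) -/(Y i) -/(Y j).
    by apply/matrixP => p q; rewrite !mxE; ring.
  have lij' : v2 * (X i - X j) = v1 * (Y i - Y j).
    by move: lij; rewrite /l => lij; lra.
  rewrite /v scalerDr !scalerA; congr (_ *: _ + _ *: _).
    apply: (mulIf vn); rewrite mulrAC divfK //.
    transitivity ((X i - X j) * v1 ^+ 2 + v2 * (v2 * (X i - X j))); first by ring.
    by rewrite lij'; ring.
  apply: (mulIf vn); rewrite mulrAC divfK //.
  transitivity (v1 * (v1 * (Y i - Y j)) + (Y i - Y j) * v2 ^+ 2); first by ring.
  by rewrite -lij'; ring.
have [k dPk] := par _ _ (esym s34).
pose dP := m (s (inord 4)) - m (s (inord 3)).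
have dP0 : dP != 0.
  apply/eqP => /eqP; rewrite subr_eq0 => /eqP e; apply: sneq.
  by rewrite e.
have k0 : k != 0.
  by apply: contra_neq dP0 => k0; rewrite /dP dPk k0 scale0r.
have dB : M (s (inord 4)) - M (s (inord 3)) = A *m dP by rewrite -!fM affine_sub.
have ndP : dot n dP = 0 by exact: plane_sub.
have AdP : dot (A *m dP) (A *m dP) = dot dP dP.
  by rewrite /dP dPk -scalemxAr !dotZl !dotZr Avv.
right; exists s; split; last first.
  move=> u Uu; exists 1; rewrite scale1r dB -/dP.
  by rewrite /dP dPk -!scalemxAr Qv.
split.
  by rewrite dB; apply: contra_neq dP0 => /affine_inj; apply.
have cong (p : vec) : congruent_on [set x | plane n c x /\ Defs.line p (A *m dP) (f x)] f.
  apply: (congruent_on_parallel (d := dP)) => //; first by move=> x [].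
  move=> x y [_ [tx ->]] [_ [ty ->]]; exists (tx - ty).
  by rewrite opprD addrACA subrr add0r scalerBl.
exists (M (s ord0)); rewrite dB; split; last by split; exact: cong.
move=> i i3; have [k' e] : exists k', m (s i) - m (s ord0) = k' *: v.
  by apply: par; rewrite /l /X /Y s3 // s3.
(* The difference of the platform points is [k' *: v], while [dP] is [k *: v]. *)
exists (k' / k); rewrite /dP dPk -scalemxAr scalerA divfK // scalemxAr -e.
by rewrite -affine_sub // !fM addrC subrK.
Qed.

Lemma cvg_row_entry (x : 'rV[R]_2) j : (fun y : 'rV[R]_2 => y 0 j) @ x --> x 0 j.
Proof. exact: (coord_continuous (i := 0) (j := j)). Qed.

Lemma ball_coord (x y : 'rV[R]_2) e j : ball x e y -> x 0 j - e < y 0 j < x 0 j + e.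
Proof.
by case=> _ /(_ 0 j); rewrite /ball /= ltr_norml => /andP[h1 h2]; apply/andP; split; lra.
Qed.

Lemma row2P (x y : 'rV[R]_2) : x 0 0 = y 0 0 -> x 0 1 = y 0 1 -> x = y.
Proof.
move=> h0 h1; apply/rowP => -[[|[|]] hj] //.
  by rewrite (_ : Ordinal hj = 0) //; apply: val_inj.
by rewrite (_ : Ordinal hj = 1) //; apply: val_inj.
Qed.

(** * Existence of the two kinds of self-motion *)

Lemma congruent_motion : congruent_on (plane n c) f ->
  exists r U phi, two_dim_self_motion m M r U phi /\ pure_translation U phi.
Proof.
move=> cong; have [e1 [e2 [oe n1 n2]]] := exists_orthonormal n0.
have nrm v : dot n v = 0 -> dot (A *m v) (A *m v) = dot v v.
  move=> nv; have hx := mP ord0; have hy := plane_add hx nv.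
  have := edist_eq_dot (cong _ _ hy hx); rewrite affine_sub //.
  by rewrite addrAC subrr add0r.
have oE : orthonormal2 (A *m e1) (A *m e2).
  have [e11 e22 e12] := oe; split; rewrite ?nrm //.
  (* Polarisation: preserved lengths of [e1], [e2] and [e1 + e2] give orthogonality of the
     images. *)
  have : dot n (e1 + e2) = 0 by rewrite dotDr n1 n2 addr0.
  move/nrm; rewrite mulmxDr !dot_lin !nrm // e12 (dotC e2) e12 (dotC (A *m e2)).
  by lra.
pose Q := frame_rot e1 e2 (A *m e1) (A *m e2).
have QA x : dot n x = 0 -> Q *m x = A *m x.
  move=> nx; rewrite (plane_expand oe n1 n2 nx) !mulmxDr -!scalemxAr.
  by rewrite /Q frame_rot1 // frame_rot2.
(* All leg vectors equal [g x], which runs over part of the unit hemisphere; on the ball of radius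
   [1 / 2], a square, the radicand stays positive. *)
pose g (x : 'rV[R]_2) := vec3 (x 0 0) (x 0 1) (Num.sqrt (1 - x 0 0 ^+ 2 - x 0 1 ^+ 2)).
pose phi x : pose R := (Q, M ord0 - Q *m m ord0 + g x).
exists (fun=> 1), (ball (0 : 'rV[R]_2) (1 / 2)), phi; split; last by [].
split; first exact: ball_open.
split; first by exists 0; apply: ballxx; rewrite divr_gt0.
split; [|split].
- move=> x _; have c1 := @cvg_row_entry x 0; have c2 := @cvg_row_entry x 1.
  suff ct : (fun y => M ord0 - Q *m m ord0 + g y) @ x --> M ord0 - Q *m m ord0 + g x.
    by apply: (@cvg_pose _ _ (nbhs x)); [exact: cvg_cst|exact: ct].
  apply: (@cvg_addv _ _ (nbhs x)); first exact: cvg_cst.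
  apply: (@cvg_vec3 _ _ (nbhs x)) => //; apply: (@cvg_sqrt _ _ (nbhs x)).
  apply: (@cvgB _ _ _ (nbhs x)); last exact: (@cvgM _ _ (nbhs x)).
  by apply: (@cvgB _ _ _ (nbhs x)); [exact: cvg_cst|exact: (@cvgM _ _ (nbhs x))].
- move=> x y _ _ [] /addrI e.
  have e0 := congr1 (fun v : vec => v (inord 0) 0) e.
  have e1' := congr1 (fun v : vec => v (inord 1) 0) e.
  by apply: row2P; [move: e0|move: e1']; rewrite !mxE !inordK.
- move=> x bx; split; first exact: frame_rotP.
  move=> i; rewrite edistE.
  have -> : Defs.act (phi x) (m i) - M i = g x.
    have : Q *m (m i - m ord0) = M i - M ord0 by rewrite QA ?plane_sub // -affine_sub // !fM.
    rewrite mulmxBr => /eqP; rewrite subr_eq => /eqP; rewrite /Defs.act /= => ->.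
    by apply/matrixP => p q; rewrite !mxE; ring.
  rewrite dotE !mxE !inordK //= -!expr2 sqr_sqrtr.
    by rewrite (_ : _ + _ = 1) ?sqrtr1 //; ring.
  have := ball_coord 0 bx; have := ball_coord 1 bx.
  by rewrite !mxE => /andP[? ?] /andP[? ?]; nra.
Qed.

(** With [v] along the two lines and [u] across them, a rotation with [Q v = A v] makes the leg
    vector independent of the coordinate along [v]. Only the levels [Y = 0] and [Y = y1] remain, and
    both get the same leg length from the strip construction. *)
Lemma schoenflies_motion s : case2 m M (plane n c) f s ->
  exists r U phi, two_dim_self_motion m M r U phi /\
    schoenflies U phi (m (s (inord 4)) - m (s (inord 3))) (M (s (inord 4)) - M (s (inord 3))).
Proof.
set dP := m _ - m _; set dB := M _ - M _.
move=> [dB0 [pg [hk [_ hh]]]]; rewrite -/dB in dB0 hk hh.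
have dPB : A *m dP = dB by rewrite /dB -!fM affine_sub.
have ndP : dot n dP = 0 by exact: plane_sub.
have len : dot dB dB = dot dP dP.
  rewrite /dB -!fM; apply/edist_eq_dot/hh; split=> //; rewrite fM.
    by exists 1; rewrite scale1r /dB addrC subrK.
  by exists 0; rewrite scale0r addr0.
have L0 : 0 < dot dP dP by rewrite -len dot_gt0.
have [L [v [dPv vv Ln0]]] : exists L v, [/\ dP = L *: v, dot v v = 1 & L != 0].
  pose L := Num.sqrt (dot dP dP); have Ln0 : L != 0 by rewrite gt_eqF // sqrtr_gt0.
  exists L, (L^-1 *: dP); split=> //; first by rewrite scalerA divff // scale1r.
  have LL : L ^+ 2 = dot dP dP by rewrite sqr_sqrtr // ltW.
  by rewrite dotZl dotZr -LL; field.
have nv : dot n v = 0.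
  by move/eqP: ndP; rewrite dPv dotZr mulf_eq0 (negPf Ln0) => /eqP.
have [e1 [e2 [oe n1 n2]]] := exists_orthonormal n0.
have [e11 e22 e12] := oe.
have [p [q [vE pq]]] : exists p q, v = p *: e1 + q *: e2 /\ p ^+ 2 + q ^+ 2 = 1.
  have vE := plane_expand oe n1 n2 nv; exists (dot v e1), (dot v e2); split=> //.
  by move: (congr1 (dot v) vE); rewrite vv dotDr !dotZr -!expr2 => <-.
(* The vector [v] turned by a right angle within the platform plane. *)
pose u := (- q) *: e1 + p *: e2.
have nu : dot n u = 0 by rewrite /u dotDr !dotZr n1 n2 !mulr0 addr0.
have ovu : orthonormal2 v u.
  split=> //; rewrite ?vE /u !dot_lin e11 e22 e12 (dotC e2) e12; last by ring.
  by transitivity (p ^+ 2 + q ^+ 2); [ring|exact: pq].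
clearbody u.
have uu : dot u u = 1 by case: ovu.
have uv : dot v u = 0 by case: ovu.
pose F1 := A *m v.
have F11 : dot F1 F1 = 1.
  apply: (mulfI Ln0); apply: (mulfI Ln0); rewrite -dotZr -dotZl /F1 scalemxAr -dPv dPB len.
  by rewrite dPv dotZl dotZr vv.
(* Gram-Schmidt in the base: [F2] is chosen so that [A *m u] is [cc *: F1 + d *: F2] with positive
   [d]. *)
pose cc := dot (A *m u) F1; pose g := A *m u - cc *: F1.
have g0 : g != 0.
  apply/eqP; rewrite /g /F1 scalemxAr -mulmxBr => /affine_inj h.
  have : dot (u - cc *: v) u = 0.
    by rewrite h ?dot0l // dotDr dotNr dotZr nu nv mulr0 subrr.
  by rewrite !dot_lin uu uv mulr0 subr0 => /eqP; rewrite oner_eq0.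
pose d := Num.sqrt (dot g g).
have dd : d ^+ 2 = dot g g by rewrite sqr_sqrtr // dot_ge0.
have dn0 : d != 0 by rewrite gt_eqF // sqrtr_gt0 dot_gt0.
pose F2 := d^-1 *: g.
have Au : A *m u = cc *: F1 + d *: F2.
  by rewrite /F2 scalerA divff // scale1r /g addrC subrK.
have gF1 : dot g F1 = 0 by rewrite /g !dot_lin F11 -/cc; ring.
have oF : orthonormal2 F1 F2.
  split=> //; first by rewrite /F2 dotZl dotZr -dd; field.
  by rewrite /F2 dotZr (dotC F1) gF1 mulr0.
have [me ME] := anchor_coords (s ord0) ovu nv nu.
pose X i := dot (m i - m (s ord0)) v; pose Y i := dot (m i - m (s ord0)) u.
pose y1 := Y (s (inord 3)).
have Yi i : Y i = 0 \/ Y i = y1.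
  rewrite -(permKV s i); set k := (s^-1)%g i.
  have [k3|k3] := ltnP k 3.
    left; have [a ha] := hk k k3; have [a' ha'] := hk ord0 isT.
    have e : m (s k) - m (s ord0) = (a - a') *: dP.
      apply/eqP; rewrite -subr_eq0; apply/eqP/affine_inj.
        by rewrite dotDr dotNr plane_sub // dotZr ndP mulr0 subrr.
      rewrite mulmxBr -affine_sub // !fM ha ha' -scalemxAr dPB.
      by rewrite opprD addrACA subrr add0r scalerBl subrr.
    by rewrite /Y e dPv !dotZl uv !mulr0.
  right; have [->|->] // : k = inord 3 \/ k = inord 4.
    by case: k k3 => [[|[|[|[|[|]]]]] hk'] //= _; [left|right]; apply: val_inj; rewrite /= inordK.
  rewrite /y1 /Y; apply/eqP; rewrite -subr_eq0 -dotNl -dotDl opprB addrA subrK -/dP.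
  by rewrite dPv dotZl uv mulr0.
pose rt S := strip_rot v u F1 F2 S; pose ws S t := strip_w F1 F2 cc d y1 S t.
pose phi (x : 'rV[R]_2) : pose R :=
  (rt (x 0 0), M (s ord0) - rt (x 0 0) *m m (s ord0) + ws (x 0 0) (x 0 1)).
(* The centre and the radius keep the sine [S] inside [(0, 1)] and the parameter [t] below 1 in
   absolute value. *)
pose U : set 'rV[R]_2 := ball (pt (1 / 2) 0) (1 / 4).
have US x : U x -> 0 < x 0 0 < 1.
  by move=> /(ball_coord 0); rewrite !mxE /= => /andP[? ?]; apply/andP; split; lra.
have Ut x : U x -> x 0 1 ^+ 2 <= 1.
  by move=> /(ball_coord 1); rewrite !mxE /= => /andP[? ?]; nra.
have rtv S : rt S *m v = F1 by rewrite /rt /strip_rot frame_rot1.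
have rtu S : rt S *m u = strip_dir F1 F2 S by rewrite /rt /strip_rot frame_rot2.
exists (fun=> Num.sqrt (strip_rho cc d y1)), U, phi; split; last first.
  by move=> x Ux; exists 1; rewrite scale1r /= dPv -scalemxAr rtv /F1 scalemxAr -dPv.
split; first exact: ball_open.
split; first by exists (pt (1 / 2) 0); apply: ballxx; rewrite divr_gt0.
split; [|split].
- move=> x Ux; have c1 := @cvg_row_entry x 0; have c2 := @cvg_row_entry x 1.
  have crt : (fun y : 'rV[R]_2 => rt (y 0 0)) @ x --> rt (x 0 0).
    exact: (@cvg_strip_rot _ _ _ _ _ _ (nbhs x)).
  suff ct : (fun y : 'rV[R]_2 => M (s ord0) - rt (y 0 0) *m m (s ord0) + ws (y 0 0) (y 0 1)) @ x
      --> M (s ord0) - rt (x 0 0) *m m (s ord0) + ws (x 0 0) (x 0 1).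
    by apply: (@cvg_pose _ _ (nbhs x)); [exact: crt|exact: ct].
  apply: (@cvg_addv _ _ (nbhs x)).
    apply: (@cvg_subv _ _ (nbhs x)); first exact: cvg_cst.
    by apply: (@cvg_mulmx _ _ (nbhs x)); exact: crt.
  by apply: (@cvg_strip_w _ _ _ _ _ _ oF _ (nbhs x)) => //; exact: US.
- move=> x y Ux Uy []; move=> eQ et.
  (* The rotation determines [S] as the component of the image of [u] along [cross F1 F2]; the
     translation then determines [t]. *)
  have e0 : x 0 0 = y 0 0.
    have := congr1 (fun B => dot (B *m u) (cross F1 F2)) eQ.
    by rewrite /= !rtu !strip_dir_F3 //; exact: US.
  apply: row2P => //; move: et; rewrite e0 => /addrI.
  move/(congr1 (fun z => dot z (strip_p F1 F2 d (y 0 0)))).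
  rewrite /ws !strip_w_p // => /mulIf; apply.
  by rewrite gt_eqF // strip_pp_gt0 //; exact: US.
- move=> x Ux; split.
    by apply: frame_rotP => //; apply: strip_dir_orthonormal => //; exact: US.
  move=> i; rewrite edistE.
  have -> : Defs.act (phi x) (m i) - M i =
      ws (x 0 0) (x 0 1) + Y i *: strip_B F1 F2 cc d (x 0 0).
    rewrite /Defs.act /= {1}(me i) (ME i) !mulmxDr -!scalemxAr rtv rtu Au /strip_B.
    rewrite -/F1 -/(X i) -/(Y i); move: (rt _ *m _) (strip_dir _ _ _) (ws _ _) (X i) (Y i).
    by move=> a D w x' y'; apply/matrixP => k l; rewrite !mxE; ring.
  by rewrite /ws strip_leg //; [exact: US|exact: Ut].
Qed.

End PlanarAffine.

Theorem theorem3 (R : realType) (m M : 'I_5 -> 'cV[R]_3)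
    (nP nQ : 'cV[R]_3) (cP cQ : R) (f : 'cV[R]_3 -> 'cV[R]_3) :
  nP != 0 -> nQ != 0 ->
  (forall i, plane nP cP (m i)) -> (forall i, plane nQ cQ (M i)) ->
  regular_affine_between (plane nP cP) (plane nQ cQ) f ->
  (forall i, f (m i) = M i) ->
  ~ all_collinear m -> ~ all_collinear M ->
  ~ arch_singular m M ->
  (has_mobility2 m M <->
     (congruent_on (plane nP cP) f \/ exists s : 'S_5, case2 m M (plane nP cP) f s))
  /\
  (forall r U phi, two_dim_self_motion m M r U phi ->
     (congruent_on (plane nP cP) f /\ pure_translation U phi) \/
     (exists s : 'S_5, case2 m M (plane nP cP) f s /\
        schoenflies U phi (m (s (inord 4)) - m (s (inord 3)))
                          (M (s (inord 4)) - M (s (inord 3)))))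
  /\
  (congruent_on (plane nP cP) f ->
     exists r U phi, two_dim_self_motion m M r U phi /\ pure_translation U phi)
  /\
  (forall s : 'S_5, case2 m M (plane nP cP) f s ->
     exists r U phi, two_dim_self_motion m M r U phi /\
       schoenflies U phi (m (s (inord 4)) - m (s (inord 3)))
                         (M (s (inord 4)) - M (s (inord 3)))).
Proof.
move=> nP0 nQ0 mP MQ [[A [b fA]] [fPQ [finj fsurj]]] fM mnc Mnc ns.
have cases r U phi := motion_cases nP0 mP fA finj fM (r := r) (U := U) (phi := phi) ns.
have case1 := congruent_motion nP0 mP fA fM.
have case2P s := schoenflies_motion nP0 mP fA finj fM (s := s).
split; last by split=> [r U phi /cases //|]; split.
split=> [[r [U [phi /cases]]]|].
  by case=> [[cong _]|[s [hs _]]]; [left|right; exists s].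
by case=> [/case1|[s /case2P]] [r [U [phi [motion _]]]]; exists r, U, phi.
Qed.
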